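(* Let $C\subset\mathbb{R}^3$ be the image of an embedded regular curve defined on a bounded closed interval, of length $l>0$ and with nowhere vanishing curvature, and let $\Gamma\subset\mathbb{R}^2$ be the image of an arc-length parametrized regular plane curve $\gamma:[-l/2,l/2]\to\mathbb{R}^2$ without self-intersections. Assume $\mathcal{P}_*(\Gamma,|C|)$ is non-empty. Then the number $n$ of distinct elements of $\mathcal{P}_*(\Gamma,|C|)$ (as germs of subsets of $\mathbb{R}^3$ along $C$) is $n=4$ if $\Gamma$ has no symmetries, and $n=2$ otherwise.
   Context: Orientation: $C$ carries an orientation; $-C$ is $C$ with the opposite orientation and $|C|$ the unoriented curve. Let $J=[-l/2,l/2]$ and $\mathbf c:J\to\mathbb R^3$ an arc-length parametrization of $C$ inducing its orientation. For a regular parametrization $\mathbf c_f$ of $C$ we use its curvature $\kappa_f$, torsion $\tau_f$ and Frenet frame $(\mathbf e,\mathbf n,\mathbf b)$. Developable strips: a developable strip along $C$ is the germ along $C$ of a $C^\infty$ embedding $f(u,v)=f(u,0)+v\,\xi_f(u)$ defined on a neighbourhood of $J_0\times\{0\}$ in $J_0\times\mathbb R$ ($J_0$ a closed interval) such that $\mathbf c_f(u):=f(u,0)$ parametrizes $C$, $\xi_f$ is a unit vector field, and the Gaussian curvature of $f$ vanishes identically. Write $\xi_f=\cos\beta_f\,\mathbf e+\sin\beta_f(\cos\alpha_f\,\mathbf n+\sin\alpha_f\,\mathbf b)$ with the Frenet frame of $\mathbf c_f$. $\mathcal D(C)$ is the set of developable strips along $C$ such that $\mathbf c_f$ induces the orientation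 of $C$ and $0<|\cos\alpha_f|<1$; one normalizes $0<|\alpha_f|<\pi/2$ (first angular function) and $0<\beta_f<\pi$ (second angular function); vanishing Gaussian curvature is equivalent to $\cot\beta_f=(\alpha_f'+|\mathbf c_f'|\tau_f)/(|\mathbf c_f'|\kappa_f\sin\alpha_f)$. The geodesic curvature function is $\mu_f:=\kappa_f\cos\alpha_f>0$. $f$ is admissible if $\mu_f(u)<\min_w\kappa_f(w)$ for all $u$; $\mathcal D_*(C)$ is the set of admissible strips, and $\mathcal D_*(|C|):=\mathcal D_*(C)\cup\mathcal D_*(-C)$. Normal forms: a normal form is a developable strip $F(s,v)$ defined near $J\times\{0\}$ such that $s\mapsto F(s,0)$ is an arc-length parametrization of $C$. A normal form is determined by this parametrization and its first angular function, and every smooth function with values in $(-\pi/2,\pi/2)\setminus\{0\}$ occurs. The dual $\check F$ of a normal form $F$ is the normal form with $\check F(s,0)=F(s,0)$ and first angular function $-\alpha_F$. Curved foldings: the origami map of a normal form $F$ is $\Phi_F(s,v)=F(s,v)$ for $v\ge 0$ and $\Phi_F(s,v)=\check F(s,v)$ for $v<0$. Two functions $\mu_1,\mu_2$ on $[-l/2,l/2]$ are equi-affine equivalent if $\mu_2(\sigma s+d)=\mu_1(s)$ for some $\sigma\in\{1,-1\}$, $d\in\mathbb R$. $\Gamma$ is a generator (crease pattern) of $F$ if the curvature function of $\gamma$ is equi-affine equivalent to $\mu_F$. $\mathcal P_*(\Gamma,|C|)$ is the set of germs along $C$ of the images $\Phi_F(J\times(-\epsilon,\epsilon))$, $F$ ranging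 over normal forms in $\mathcal D_*(|C|)$ having generator $\Gamma$; two such germs are equal if the images coincide for all sufficiently small $\epsilon>0$. Symmetry: a subset $A\subset\mathbb R^k$ ($k=2,3$) has a symmetry if $T(A)=A$ for some isometry $T$ of $\mathbb R^k$ other than the identity. *)

(* Defs.v *)
From Stdlib Require Import Reals Lra List.
From Coquelicot Require Import Coquelicot.
Open Scope R_scope.

Definition smooth_fun (f : R -> R) : Prop :=
  forall (n : nat) (x : R), ex_derive (Derive_n f n) x.

Record V3 := mkV3 { x1 : R; x2 : R; x3 : R }.
Record V2 := mkV2 { y1 : R; y2 : R }.

Definition vadd (u v : V3) : V3 := mkV3 (x1 u + x1 v) (x2 u + x2 v) (x3 u + x3 v).
Definition vscal (k : R) (u : V3) : V3 := mkV3 (k * x1 u) (k * x2 u) (k * x3 u).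
Definition vdot (u v : V3) : R := x1 u * x1 v + x2 u * x2 v + x3 u * x3 v.
Definition vcross (u v : V3) : V3 :=
  mkV3 (x2 u * x3 v - x3 u * x2 v) (x3 u * x1 v - x1 u * x3 v) (x1 u * x2 v - x2 u * x1 v).
Definition vnorm (u : V3) : R := sqrt (vdot u u).

Definition wnorm (p : V2) : R := sqrt (y1 p * y1 p + y2 p * y2 p).
Definition wdist (p q : V2) : R := wnorm (mkV2 (y1 p - y1 q) (y2 p - y2 q)).

Definition vsmooth (c : R -> V3) : Prop :=
  smooth_fun (fun t => x1 (c t)) /\ smooth_fun (fun t => x2 (c t)) /\
  smooth_fun (fun t => x3 (c t)).
Definition vderiv (c : R -> V3) : R -> V3 := fun t =>
  mkV3 (Derive (fun u => x1 (c u)) t) (Derive (fun u => x2 (c u)) t)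
       (Derive (fun u => x3 (c u)) t).

Definition wsmooth (g : R -> V2) : Prop :=
  smooth_fun (fun t => y1 (g t)) /\ smooth_fun (fun t => y2 (g t)).
Definition wderiv (g : R -> V2) : R -> V2 := fun t =>
  mkV2 (Derive (fun u => y1 (g u)) t) (Derive (fun u => y2 (g u)) t).

Definition curv (c : R -> V3) (t : R) : R :=
  vnorm (vcross (vderiv c t) (vderiv (vderiv c) t)) / (vnorm (vderiv c t) ^ 3).
Definition tors (c : R -> V3) (t : R) : R :=
  vdot (vcross (vderiv c t) (vderiv (vderiv c) t)) (vderiv (vderiv (vderiv c)) t)
  / (vnorm (vcross (vderiv c t) (vderiv (vderiv c) t)) ^ 2).
Definition tangent (c : R -> V3) (t : R) : V3 := vscal (/ vnorm (vderiv c t)) (vderiv c t).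
Definition binormal (c : R -> V3) (t : R) : V3 :=
  vscal (/ vnorm (vcross (vderiv c t) (vderiv (vderiv c) t)))
        (vcross (vderiv c t) (vderiv (vderiv c) t)).
Definition normal (c : R -> V3) (t : R) : V3 := vcross (binormal c t) (tangent c t).

Definition curv2 (g : R -> V2) (t : R) : R :=
  Rabs (y1 (wderiv g t) * y2 (wderiv (wderiv g) t) - y2 (wderiv g t) * y1 (wderiv (wderiv g) t))
  / (wnorm (wderiv g t) ^ 3).

Definition inJ (l s : R) : Prop := - (l / 2) <= s <= l / 2.

(* cot of the second angular function, from the vanishing of the Gaussian curvature:
   cot beta = (alpha' + |c'| tau) / (|c'| kappa sin alpha)                            *)
Definition cotbeta (c : R -> V3) (alpha : R -> R) (s : R) : R :=
  (Derive alpha s + vnorm (vderiv c s) * tors c s)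
  / (vnorm (vderiv c s) * curv c s * sin (alpha s)).

(* ruling direction xi = cos b e + sin b (cos a n + sin a b), with 0 < beta < pi,
   i.e. sin beta = 1/sqrt(1+cot^2), cos beta = cot * sin beta                    *)
Definition ruling (c : R -> V3) (alpha : R -> R) (s : R) : V3 :=
  vscal (/ sqrt (1 + cotbeta c alpha s ^ 2))
    (vadd (vscal (cotbeta c alpha s) (tangent c s))
          (vadd (vscal (cos (alpha s)) (normal c s)) (vscal (sin (alpha s)) (binormal c s)))).

Definition strip (c : R -> V3) (alpha : R -> R) (s v : R) : V3 :=
  vadd (c s) (vscal v (ruling c alpha s)).

Definition origami (c : R -> V3) (alpha : R -> R) (s v : R) : V3 :=
  if Rle_dec 0 v then strip c alpha s v else strip c (fun t => - alpha t) s v.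

Definition origami_image (l : R) (c : R -> V3) (alpha : R -> R) (eps : R) : V3 -> Prop :=
  fun p => exists s v, inJ l s /\ - eps < v < eps /\ origami c alpha s v = p.

Definition germ (A : R -> V3 -> Prop) : (R -> V3 -> Prop) -> Prop :=
  fun B => exists e0, 0 < e0 /\ forall e, 0 < e < e0 -> forall p, B e p <-> A e p.

(* c0 o phi is an arc-length parametrization on J of the curve c0|[a,b],
   inducing either orientation (this covers D(C) u D(-C), i.e. |C|) *)
Definition arclength_param (c0 : R -> V3) (a b l : R) (phi : R -> R) : Prop :=
  smooth_fun phi /\
  ((phi (- (l / 2)) = a /\ phi (l / 2) = b) \/ (phi (- (l / 2)) = b /\ phi (l / 2) = a)) /\
  (forall s, inJ l s -> a <= phi s <= b) /\
  (forall s, inJ l s -> vnorm (vderiv (fun u => c0 (phi u)) s) = 1).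

Definition admissible_nf_with_generator (c0 : R -> V3) (a b l : R) (gamma : R -> V2)
    (phi alpha : R -> R) : Prop :=
  let c := fun u => c0 (phi u) in
  arclength_param c0 a b l phi /\
  smooth_fun alpha /\
  (forall s, inJ l s -> - (PI / 2) < alpha s < PI / 2 /\ alpha s <> 0) /\
  (* admissibility: mu_F(u) < min_w kappa(w) *)
  (forall u w, inJ l u -> inJ l w -> curv c u * cos (alpha u) < curv c w) /\
  (* generator: curvature of gamma equi-affine equivalent to mu_F *)
  (exists sigma d, (sigma = 1 \/ sigma = -1) /\
     forall s, inJ l s -> inJ l (sigma * s + d) /\
               curv2 gamma (sigma * s + d) = curv c s * cos (alpha s)).

Definition P_star (c0 : R -> V3) (a b l : R) (gamma : R -> V2)
    : ((R -> V3 -> Prop) -> Prop) -> Prop :=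
  fun g => exists phi alpha, admissible_nf_with_generator c0 a b l gamma phi alpha /\
                             g = germ (origami_image l (fun u => c0 (phi u)) alpha).

Definition has_card {T : Type} (P : T -> Prop) (n : nat) : Prop :=
  exists L : list T, length L = n /\ NoDup L /\ forall x, P x <-> In x L.

Definition has_symmetry2 (A : V2 -> Prop) : Prop :=
  exists T : V2 -> V2,
    (forall p q, wdist (T p) (T q) = wdist p q) /\
    (exists p, T p <> p) /\
    (forall q, A q <-> exists p, A p /\ T p = q).

(* Main.v *)
Require Import Defs.
From Stdlib Require Import Reals Lra List Classical ClassicalEpsilon.
From Stdlib Require Import FunctionalExtensionality PropExtensionality.
From Coquelicot Require Import Coquelicot.
Open Scope R_scope.

(* The arc-length parametrization is unique up to s -> -s, and reversing it while replacing
   alpha(s) by -alpha(-s) does not change the origami image, so one may fix a parametrization c.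
   With K the curvature of gamma, the generator condition then reads kappa(s) cos alpha(s) = K(s)
   or K(-s), i.e. alpha = +-arccos(K(+-s) / kappa(s)): admissibility gives 0 < K < kappa, hence
   all four functions are smooth near J and extend by a cutoff.  The germ of the image determines
   alpha, because the half-rulings at c(s0), projected to the normal plane, can be recovered from
   it.  So there are four germs, or two when K is even, and K is even exactly when Gamma has a
   symmetry: a symmetry acts on arc length by s -> -s (it is the identity if it acts by s -> s,
   as K > 0), and conversely an even K makes Gamma invariant under the reflection in its normal
   at gamma(0). *)

(** * Pointwise C^n regularity *)

(** The obstacle is that [smooth_fun] demands smoothness on all of R, while the curvature bounds and
    the conditions on alpha are available only on the closed interval J. Smoothness is therefore
    handled pointwise through [Ck_at], whose derivative is an existentially chosen function valid
    near the point; closure under the operations becomes an induction, and a cutoff then produces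
    global functions. Conversely, parametrizations and angular functions are determined only on J,
    so two-sided derivatives at its end points have to be recovered from inward increments. The germ
    yields alpha although beta involves alpha': in the normal plane a ruling is a positive multiple
    of (cos alpha, sin alpha), with cos alpha > 0. The sheet v < 0 consists of negative multiples of
    dual rulings, so its points leave c(s0) with negative normal component and cannot be confused
    with the sheet v >= 0. Isometries of the plane enter only through the distances they preserve,
    without any matrix form. *)

Fixpoint Ck_at (n : nat) (f : R -> R) (x : R) : Prop :=
  match n with
  | O => continuous f x
  | S m => exists f', locally x (fun y => is_derive f y (f' y)) /\ Ck_at m f' x
  end.

Lemma is_derive_multR (f g : R -> R) (x a b : R) :
  is_derive f x a -> is_derive g x b ->
  is_derive (fun y => f y * g y) x (a * g x + f x * b).
Proof. intros Hf Hg. exact (is_derive_mult f g x a b Hf Hg Rmult_comm). Qed.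

Lemma is_derive_compR (f g : R -> R) (x a b : R) :
  is_derive f (g x) a -> is_derive g x b -> is_derive (fun y => f (g y)) x (b * a).
Proof. intros Hf Hg. exact (is_derive_comp f g x a b Hf Hg). Qed.

Lemma is_derive_plusR (f g : R -> R) (x a b : R) :
  is_derive f x a -> is_derive g x b -> is_derive (fun y => f y + g y) x (a + b).
Proof. intros Hf Hg. exact (is_derive_plus f g x a b Hf Hg). Qed.

Lemma is_derive_minusR (f g : R -> R) (x a b : R) :
  is_derive f x a -> is_derive g x b -> is_derive (fun y => f y - g y) x (a - b).
Proof. intros Hf Hg. exact (is_derive_minus f g x a b Hf Hg). Qed.

Lemma is_derive_eq (f : R -> R) (x a b : R) : is_derive f x a -> a = b -> is_derive f x b.
Proof. now intros H <-. Qed.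

Lemma is_derive_reflect (f : R -> R) (x a : R) :
  is_derive f (- x) a -> is_derive (fun y => f (- y)) x (- a).
Proof.
  intros H. apply is_derive_eq with ((-1) * a); [|ring].
  apply (is_derive_compR f Ropp); [exact H|].
  auto_derive; [easy | ring].
Qed.

Lemma is_derive_continuous (f : R -> R) (x a : R) : is_derive f x a -> continuous f x.
Proof. intros H. apply (ex_derive_continuous f x). exists a. exact H. Qed.

Lemma Ck_at_continuous n f x : Ck_at n f x -> continuous f x.
Proof.
  destruct n; simpl; [easy|]. intros (f' & H & _).
  apply (is_derive_continuous f x (f' x)), (locally_singleton _ _ H).
Qed.

Lemma Ck_at_pred n f x : Ck_at (S n) f x -> Ck_at n f x.
Proof.
  revert f; induction n; intros f H.
  - now apply Ck_at_continuous in H.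
  - destruct H as (f' & H & H'). exists f'; split; [exact H | now apply IHn].
Qed.

Lemma Ck_at_ext_loc n (f g : R -> R) (x : R) :
  locally x (fun y => f y = g y) -> Ck_at n f x -> Ck_at n g x.
Proof.
  destruct n; intros E H.
  - apply (continuous_ext_loc _ f); [|exact H]. exact E.
  - destruct H as (f' & H & H'). exists f'; split; [|exact H'].
    apply locally_locally in E.
    generalize (filter_and _ _ E H). apply filter_imp; intros y [E1 H1].
    now apply (is_derive_ext_loc f).
Qed.

Lemma Ck_at_const n c x : Ck_at n (fun _ => c) x.
Proof.
  revert c; induction n; intros c; simpl.
  - apply continuous_const.
  - exists (fun _ => 0); split; [|apply IHn].
    apply filter_forall; intros y. apply (is_derive_const c y).
Qed.

Lemma Ck_at_id n x : Ck_at n (fun y => y) x.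
Proof.
  destruct n; simpl.
  - apply continuous_id.
  - exists (fun _ => 1); split; [|apply Ck_at_const].
    apply filter_forall; intros y. apply (is_derive_id y).
Qed.

Lemma Ck_at_plus n f g x :
  Ck_at n f x -> Ck_at n g x -> Ck_at n (fun y => f y + g y) x.
Proof.
  revert f g; induction n; intros f g Hf Hg.
  - apply (continuous_plus f g x Hf Hg).
  - destruct Hf as (f' & Hf & Hf'), Hg as (g' & Hg & Hg').
    exists (fun y => f' y + g' y); split; [|now apply IHn].
    generalize (filter_and _ _ Hf Hg). apply filter_imp; intros y [H1 H2].
    now apply is_derive_plusR.
Qed.

Lemma Ck_at_mult n f g x :
  Ck_at n f x -> Ck_at n g x -> Ck_at n (fun y => f y * g y) x.
Proof.
  revert f g; induction n; intros f g Hf Hg.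
  - apply (continuous_mult f g x Hf Hg).
  - pose proof (Ck_at_pred _ _ _ Hf) as Hf0; pose proof (Ck_at_pred _ _ _ Hg) as Hg0.
    destruct Hf as (f' & Hf & Hf'), Hg as (g' & Hg & Hg').
    exists (fun y => f' y * g y + f y * g' y); split.
    + generalize (filter_and _ _ Hf Hg). apply filter_imp; intros y [H1 H2].
      now apply is_derive_multR.
    + apply Ck_at_plus; now apply IHn.
Qed.

Lemma Ck_at_opp n f x : Ck_at n f x -> Ck_at n (fun y => - f y) x.
Proof.
  intros H. apply (Ck_at_ext_loc n (fun y => (-1) * f y)).
  - apply filter_forall; intros y; ring.
  - apply Ck_at_mult; [apply Ck_at_const | exact H].
Qed.

Lemma Ck_at_minus n f g x :
  Ck_at n f x -> Ck_at n g x -> Ck_at n (fun y => f y - g y) x.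
Proof. intros Hf Hg. now apply Ck_at_plus, Ck_at_opp. Qed.

Lemma Ck_at_comp n f g x :
  Ck_at n f (g x) -> Ck_at n g x -> Ck_at n (fun y => f (g y)) x.
Proof.
  revert f g; induction n; intros f g Hf Hg.
  - now apply (continuous_comp g f).
  - pose proof (Ck_at_pred _ _ _ Hg) as Hg0.
    pose proof (Ck_at_continuous _ _ _ Hg0) as Cg.
    destruct Hf as (f' & Hf & Hf'), Hg as (g' & Hg & Hg').
    exists (fun y => g' y * f' (g y)); split.
    + apply Cg in Hf. unfold filtermap in Hf.
      generalize (filter_and _ _ Hf Hg). apply filter_imp; intros y [H1 H2].
      now apply is_derive_compR.
    + apply Ck_at_mult; [exact Hg'|]. now apply IHn.
Qed.

Lemma locally_pos (f : R -> R) (x : R) : continuous f x -> 0 < f x -> locally x (fun y => 0 < f y).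
Proof. intros Cf H. apply Cf. now apply (open_gt 0). Qed.

Lemma locally_lt (f g : R -> R) (x : R) :
  continuous f x -> continuous g x -> f x < g x -> locally x (fun y => f y < g y).
Proof.
  intros Cf Cg H.
  generalize (locally_pos (fun y => g y - f y) x (continuous_minus g f x Cg Cf) ltac:(lra)).
  apply filter_imp; intros y; lra.
Qed.

Lemma locally_neq0 (f : R -> R) (x : R) : continuous f x -> f x <> 0 -> locally x (fun y => f y <> 0).
Proof. intros Cf H. exact (Cf (fun z => z <> 0) (open_neq 0 (f x) H)). Qed.

(** The derivative is again built from [/ f], so the induction hypothesis is applied to the same [f]
    at the lower order before its derivative is unpacked. [Ck_at_sqrt] follows the same pattern. *)
Lemma Ck_at_inv n f x : Ck_at n f x -> f x <> 0 -> Ck_at n (fun y => / f y) x.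
Proof.
  revert f; induction n; intros f Hf Hx.
  - now apply continuous_Rinv_comp.
  - pose proof (IHn f (Ck_at_pred _ _ _ Hf) Hx) as Hi.
    pose proof (locally_neq0 f x (Ck_at_continuous _ _ _ Hf) Hx) as Hn.
    destruct Hf as (f' & Hf & Hf').
    exists (fun y => - f' y * (/ f y * / f y)); split.
    + generalize (filter_and _ _ Hf Hn). apply filter_imp; intros y [H1 H2].
      eapply is_derive_eq; [apply is_derive_inv; eassumption|]. now field.
    + apply Ck_at_mult; [now apply Ck_at_opp|]. now apply Ck_at_mult.
Qed.

Lemma Ck_at_div n f g x :
  Ck_at n f x -> Ck_at n g x -> g x <> 0 -> Ck_at n (fun y => f y / g y) x.
Proof. intros Hf Hg H. apply Ck_at_mult; [exact Hf | now apply Ck_at_inv]. Qed.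

Lemma Ck_at_sqrt n f x : Ck_at n f x -> 0 < f x -> Ck_at n (fun y => sqrt (f y)) x.
Proof.
  revert f; induction n; intros f Hf Hx.
  - now apply continuous_sqrt_comp.
  - pose proof (IHn f (Ck_at_pred _ _ _ Hf) Hx) as Hi.
    pose proof (locally_pos f x (Ck_at_continuous _ _ _ Hf) Hx) as Hn.
    destruct Hf as (f' & Hf & Hf').
    exists (fun y => f' y / (2 * sqrt (f y))); split.
    + generalize (filter_and _ _ Hf Hn). apply filter_imp; intros y [H1 H2].
      now apply is_derive_sqrt.
    + apply Ck_at_div; [exact Hf'|apply Ck_at_mult; [apply Ck_at_const | exact Hi]|].
      pose proof (sqrt_lt_R0 _ Hx); lra.
Qed.

Lemma Ck_at_pow n f k x : Ck_at n f x -> Ck_at n (fun y => f y ^ k) x.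
Proof.
  intros H; induction k; simpl; [apply Ck_at_const | now apply Ck_at_mult].
Qed.

Lemma Ck_at_abs n f x : Ck_at n f x -> f x <> 0 -> Ck_at n (fun y => Rabs (f y)) x.
Proof.
  intros H Hx. apply (Ck_at_ext_loc n (fun y => sqrt (f y * f y))).
  - apply filter_forall; intros y. apply sqrt_Rsqr_abs.
  - apply Ck_at_sqrt; [now apply Ck_at_mult|]. now apply Rsqr_pos_lt.
Qed.

Lemma Ck_at_sin_cos n x : Ck_at n sin x /\ Ck_at n cos x.
Proof.
  induction n as [|n [IHs IHc]].
  - split; [apply continuous_sin | apply continuous_cos].
  - split.
    + exists cos; split; [|exact IHc]. apply filter_forall; intros y. apply is_derive_sin.
    + exists (fun y => - sin y); split; [|now apply Ck_at_opp].
      apply filter_forall; intros y. apply is_derive_cos.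
Qed.

Lemma Ck_at_sin n f x : Ck_at n f x -> Ck_at n (fun y => sin (f y)) x.
Proof. intros H. apply Ck_at_comp; [apply Ck_at_sin_cos | exact H]. Qed.

Lemma Ck_at_cos n f x : Ck_at n f x -> Ck_at n (fun y => cos (f y)) x.
Proof. intros H. apply Ck_at_comp; [apply Ck_at_sin_cos | exact H]. Qed.

Lemma is_derive_acos x : -1 < x < 1 -> is_derive acos x (-1 / sqrt (1 - x * x)).
Proof.
  intros H. apply is_derive_Reals.
  generalize (proj2_sig (derivable_pt_acos x H)).
  change (proj1_sig (derivable_pt_acos x H)) with (derive_pt acos x (derivable_pt_acos x H)).
  now rewrite derive_pt_acos.
Qed.

Lemma Ck_at_acos n f x : Ck_at n f x -> -1 < f x < 1 -> Ck_at n (fun y => acos (f y)) x.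
Proof.
  intros Hf Hx. apply Ck_at_comp; [|exact Hf].
  assert (HL : locally (f x) (fun y => is_derive acos y (-1 / sqrt (1 - y * y)))).
  { generalize (filter_and _ _ (open_gt (-1) (f x) (proj1 Hx)) (open_lt 1 (f x) (proj2 Hx))).
    apply filter_imp; intros y Hy. now apply is_derive_acos. }
  destruct n.
  - apply (is_derive_continuous _ _ _ (is_derive_acos _ Hx)).
  - exists (fun y => -1 / sqrt (1 - y * y)); split; [exact HL|].
    assert (0 < 1 - f x * f x) by nra.
    apply Ck_at_div; [apply Ck_at_const | |].
    + apply Ck_at_sqrt; [|easy].
      apply Ck_at_minus; [apply Ck_at_const | apply Ck_at_mult; apply Ck_at_id].
    + apply Rgt_not_eq. now apply sqrt_lt_R0.
Qed.

Lemma Derive_n_S f n x : Derive_n f (S n) x = Derive_n (Derive f) n x.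
Proof. rewrite <- (Nat.add_1_r n), <- Derive_n_comp. reflexivity. Qed.

Lemma smooth_fun_Derive f : smooth_fun f -> smooth_fun (Derive f).
Proof.
  intros H n x. apply (ex_derive_ext (Derive_n f (S n))); [|apply H].
  intros t. apply Derive_n_S.
Qed.

Lemma smooth_fun_is_derive f x : smooth_fun f -> is_derive f x (Derive f x).
Proof. intros H. apply Derive_correct. apply (H O). Qed.

Lemma smooth_fun_Ck_at f n x : smooth_fun f -> Ck_at n f x.
Proof.
  revert f; induction n; intros f H.
  - apply (is_derive_continuous _ _ _ (smooth_fun_is_derive f x H)).
  - exists (Derive f); split; [|apply IHn, smooth_fun_Derive, H].
    apply filter_forall; intros y. now apply smooth_fun_is_derive.
Qed.

(** [Derive_n] iterates [Derive], so the chosen derivative is exchanged for [Derive f] on a whole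
    neighbourhood before the next differentiation. *)
Lemma Ck_at_ex_derive f n x : Ck_at (S n) f x -> ex_derive (Derive_n f n) x.
Proof.
  revert f; induction n; intros f (f' & H & H').
  - exists (f' x). apply (locally_singleton _ _ H).
  - apply (ex_derive_ext_loc (Derive_n f' n)); [|now apply IHn].
    apply locally_locally in H. revert H; apply filter_imp; intros y H.
    rewrite Derive_n_S. apply Derive_n_ext_loc.
    revert H; apply filter_imp; intros z H. symmetry. now apply is_derive_unique.
Qed.

Lemma smooth_fun_intro f : (forall n x, Ck_at n f x) -> smooth_fun f.
Proof. intros H n x. apply Ck_at_ex_derive, H. Qed.

Lemma smooth_fun_comp f g : smooth_fun f -> smooth_fun g -> smooth_fun (fun t => f (g t)).
Proof.
  intros Hf Hg. apply smooth_fun_intro; intros n x.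
  apply Ck_at_comp; now apply smooth_fun_Ck_at.
Qed.

Lemma smooth_fun_opp f : smooth_fun f -> smooth_fun (fun t => - f t).
Proof.
  intros Hf. apply smooth_fun_intro; intros n x. now apply Ck_at_opp, smooth_fun_Ck_at.
Qed.

Lemma smooth_fun_reflect f : smooth_fun f -> smooth_fun (fun t => f (- t)).
Proof.
  intros Hf. apply (smooth_fun_comp f (fun t => - t)); [exact Hf|].
  apply smooth_fun_intro; intros n x. apply Ck_at_opp, Ck_at_id.
Qed.

(** * A smooth cutoff *)

(** The functions x^(-k) e^(-1/x) extended by 0. Allowing every [k] makes the family closed under
    differentiation; k = 0 is the classical flat function. *)
Definition flat (k : nat) (x : R) : R :=
  if Rlt_dec 0 x then (/ x) ^ k * exp (- / x) else 0.

(** A single term of the exponential series, the other terms being nonnegative. *)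
Lemma pow_le_fact_exp y n : 0 <= y -> y ^ n <= INR (Factorial.fact n) * exp y.
Proof.
  intros Hy. pose proof (exp_ge_taylor y n Hy) as H.
  pose proof (INR_fact_lt_0 n) as Hf.
  assert (H1 : y ^ n / INR (Factorial.fact n) <= exp y).
  { eapply Rle_trans; [|exact H]. destruct n; [simpl; lra|].
    rewrite tech5.
    assert (0 <= sum_f_R0 (fun k => y ^ k / INR (Factorial.fact k)) n); [|lra].
    apply cond_pos_sum; intros k. apply Rmult_le_pos; [now apply pow_le|].
    apply Rlt_le, Rinv_0_lt_compat, INR_fact_lt_0. }
  apply (Rmult_le_compat_l _ _ _ (Rlt_le _ _ Hf)) in H1.
  replace (INR (Factorial.fact n) * (y ^ n / INR (Factorial.fact n))) with (y ^ n) in H1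
    by (field; lra). exact H1.
Qed.

(** Two powers beyond [k] in the exponential bound at 1/x leave a factor x^2, enough for derivative
    0 at the origin. *)
Lemma flat_quadratic k x : Rabs (flat k x) <= INR (Factorial.fact (k + 2)) * x ^ 2.
Proof.
  pose proof (INR_fact_lt_0 (k + 2)) as Hf.
  unfold flat. destruct (Rlt_dec 0 x) as [Hx|Hx].
  - pose proof (Rinv_0_lt_compat _ Hx) as Hi.
    pose proof (pow_le_fact_exp (/ x) (k + 2) (Rlt_le _ _ Hi)) as H.
    rewrite Rabs_right.
    2: { apply Rle_ge, Rmult_le_pos; [apply pow_le; lra | apply Rlt_le, exp_pos]. }
    rewrite pow_add in H. pose proof (exp_pos (- / x)) as He.
    apply (Rmult_le_compat_r _ _ _ (Rlt_le _ _ He)) in H.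
    rewrite (Rmult_assoc (INR _) (exp _) (exp _)), <- exp_plus in H.
    replace (/ x + - / x) with 0 in H by ring. rewrite exp_0 in H.
    apply (Rmult_le_compat_r (x ^ 2)) in H; [|nra].
    replace ((/ x) ^ k * (/ x) ^ 2 * exp (- / x) * x ^ 2)
      with ((/ x) ^ k * exp (- / x)) in H; [lra|].
    field. lra.
  - rewrite Rabs_R0. apply Rmult_le_pos; [lra|]. nra.
Qed.

Lemma is_derive_quadratic_bound (f : R -> R) (M : R) :
  (forall x, Rabs (f x) <= M * x ^ 2) -> is_derive f 0 0.
Proof.
  intros H. apply is_derive_Reals. intros eps Heps.
  assert (HM : 0 < eps / (Rabs M + 1)).
  { pose proof (Rabs_pos M). apply Rdiv_lt_0_compat; lra. }
  exists (mkposreal _ HM); intros h Hh Hd; simpl in Hd.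
  assert (F0 : f 0 = 0).
  { pose proof (H 0) as H0. replace (M * 0 ^ 2) with 0 in H0 by ring.
    pose proof (Rabs_pos (f 0)). apply Rabs_eq_0; lra. }
  rewrite F0, Rplus_0_l, !Rminus_0_r. unfold Rdiv. rewrite Rabs_mult, Rabs_inv.
  pose proof (Rabs_pos_lt _ Hh) as Hp.
  apply (Rmult_lt_reg_r (Rabs h)); [exact Hp|].
  rewrite Rmult_assoc, Rinv_l, Rmult_1_r by lra.
  apply Rle_lt_trans with (Rabs M * Rabs h * Rabs h).
  - eapply Rle_trans; [apply H|]. rewrite <- (pow2_abs h).
    pose proof (Rle_abs M). simpl. rewrite Rmult_1_r, <- Rmult_assoc.
    apply Rmult_le_compat_r; [lra|]. apply Rmult_le_compat_r; lra.
  - apply Rmult_lt_compat_r; [exact Hp|].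
    pose proof (Rabs_pos M).
    apply Rle_lt_trans with ((Rabs M + 1) * Rabs h); [nra|].
    apply (Rmult_lt_compat_l (Rabs M + 1)) in Hd; [|lra].
    replace ((Rabs M + 1) * (eps / (Rabs M + 1))) with eps in Hd by (field; lra). exact Hd.
Qed.

Lemma flat_nonpos k x : x <= 0 -> flat k x = 0.
Proof. intros H. unfold flat. destruct (Rlt_dec 0 x); [lra | easy]. Qed.

Lemma flat0_pos x : 0 < x -> 0 < flat 0 x.
Proof.
  intros H. unfold flat. destruct (Rlt_dec 0 x); [|lra]. simpl. rewrite Rmult_1_l. apply exp_pos.
Qed.

Lemma flat0_nonneg x : 0 <= flat 0 x.
Proof.
  destruct (Rlt_dec 0 x) as [H|H]; [now apply Rlt_le, flat0_pos|].
  rewrite flat_nonpos; lra.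
Qed.

Lemma is_derive_flat k x :
  is_derive (flat k) x (- INR k * flat (k + 1) x + flat (k + 2) x).
Proof.
  destruct (total_order_T x 0) as [[H|H]|H].
  - rewrite !flat_nonpos by lra. replace (_ * 0 + 0) with 0 by ring.
    apply (is_derive_ext_loc (fun _ => 0)).
    + generalize (open_lt 0 x H). apply filter_imp; intros y Hy.
      symmetry; apply flat_nonpos; lra.
    + apply (is_derive_const 0 x).
  - subst x. rewrite !flat_nonpos by lra. replace (_ * 0 + 0) with 0 by ring.
    apply (is_derive_quadratic_bound _ (INR (Factorial.fact (k + 2)))). apply flat_quadratic.
  - apply (is_derive_ext_loc (fun x => (/ x) ^ k * exp (- / x))).
    + generalize (open_gt 0 x H). apply filter_imp; intros y Hy.
      unfold flat. destruct (Rlt_dec 0 y); [easy | lra].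
    + unfold flat. destruct (Rlt_dec 0 x); [|lra].
      auto_derive; [repeat split; lra|].
      (* The power rule leaves the exponent [Nat.pred k], so k = 0 is a case of its own. *)
      destruct k.
      * simpl. field. lra.
      * rewrite !pow_add, <- tech_pow_Rmult.
        replace (Nat.pred (S k)) with k by reflexivity. field. lra.
Qed.

Lemma Ck_at_flat n k x : Ck_at n (flat k) x.
Proof.
  revert k; induction n; intros k.
  - apply (is_derive_continuous _ _ _ (is_derive_flat k x)).
  - exists (fun x => - INR k * flat (k + 1) x + flat (k + 2) x); split.
    + apply filter_forall; intros y. apply is_derive_flat.
    + apply Ck_at_plus; [apply Ck_at_mult; [apply Ck_at_const|]|]; apply IHn.
Qed.

Definition smooth_step (x : R) : R := flat 0 x / (flat 0 x + flat 0 (1 - x)).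

Lemma smooth_step_den x : 0 < flat 0 x + flat 0 (1 - x).
Proof.
  pose proof (flat0_nonneg x); pose proof (flat0_nonneg (1 - x)).
  destruct (Rlt_dec 0 x) as [H1|H1].
  - pose proof (flat0_pos x H1). lra.
  - pose proof (flat0_pos (1 - x) ltac:(lra)). lra.
Qed.

Lemma smooth_step_0 x : x <= 0 -> smooth_step x = 0.
Proof. intros H. unfold smooth_step. rewrite (flat_nonpos 0 x H). unfold Rdiv; ring. Qed.

Lemma smooth_step_1 x : 1 <= x -> smooth_step x = 1.
Proof.
  intros H. pose proof (smooth_step_den x). unfold smooth_step.
  rewrite (flat_nonpos 0 (1 - x)) in * by lra. field. lra.
Qed.

Lemma Ck_at_smooth_step n x : Ck_at n smooth_step x.
Proof.
  apply Ck_at_div; [apply Ck_at_flat | apply Ck_at_plus; [apply Ck_at_flat|] |].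
  - apply (Ck_at_comp n (flat 0) (fun y => 1 - y)); [apply Ck_at_flat|].
    apply Ck_at_minus; [apply Ck_at_const | apply Ck_at_id].
  - pose proof (smooth_step_den x); lra.
Qed.

(** [h] is half the length of the interval where the value is 1, and [d] is the width of each
    transition zone. *)
Definition cutoff (h d s : R) : R :=
  smooth_step ((h + d - s) / d) * smooth_step ((h + d + s) / d).

Lemma Ck_at_cutoff h d n s : Ck_at n (cutoff h d) s.
Proof.
  apply Ck_at_mult.
  - apply (Ck_at_comp n smooth_step); [apply Ck_at_smooth_step|].
    apply Ck_at_mult; [|apply Ck_at_const].
    apply Ck_at_minus; [apply Ck_at_const | apply Ck_at_id].
  - apply (Ck_at_comp n smooth_step); [apply Ck_at_smooth_step|].
    apply Ck_at_mult; [|apply Ck_at_const].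
    apply Ck_at_plus; [apply Ck_at_const | apply Ck_at_id].
Qed.

Lemma cutoff_1 h d s : 0 < d -> - h <= s <= h -> cutoff h d s = 1.
Proof.
  intros Hd Hs. unfold cutoff.
  rewrite !smooth_step_1; [ring | |]; apply (Rmult_le_reg_r d); trivial;
    unfold Rdiv; rewrite Rmult_assoc, Rinv_l; lra.
Qed.

Lemma cutoff_0 h d s : 0 < d -> h + d <= Rabs s -> cutoff h d s = 0.
Proof.
  intros Hd Hs. unfold cutoff. pose proof (Rinv_0_lt_compat d Hd).
  unfold Rabs in Hs; destruct (Rcase_abs s).
  - rewrite (smooth_step_0 ((h + d + s) / d)); [ring|]. unfold Rdiv; nra.
  - rewrite (smooth_step_0 ((h + d - s) / d)); [ring|]. unfold Rdiv; nra.
Qed.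

(** The margin [2 * d] exceeds the transition width: a point either lies where [f] is regular or has
    a neighbourhood on which the product vanishes identically. *)
Lemma smooth_extension h d f :
  0 < d -> (forall n s, Rabs s < h + 2 * d -> Ck_at n f s) ->
  exists g, smooth_fun g /\ forall s, - h <= s <= h -> g s = f s.
Proof.
  intros Hd Hf. exists (fun s => cutoff h d s * f s); split.
  - apply smooth_fun_intro; intros n s.
    destruct (Rlt_dec (Rabs s) (h + 2 * d)) as [H|H].
    + apply Ck_at_mult; [apply Ck_at_cutoff | now apply Hf].
    + apply (Ck_at_ext_loc n (fun _ => 0)); [|apply Ck_at_const].
      assert (Ca : continuous Rabs s) by apply continuous_Rabs.
      generalize (locally_lt (fun _ => h + d) Rabs s (continuous_const _ _) Ca ltac:(lra)).
      apply filter_imp; intros y Hy. rewrite cutoff_0; lra.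
  - intros s Hs. rewrite cutoff_1; trivial; ring.
Qed.

(** * Functions on an interval *)

(** Even at an end point the two-sided derivative is a limit along inward increments, and along
    these the difference quotient of [f - g] is 0. Hence derivatives on a closed interval depend
    only on the values there. *)
Lemma is_derive_unique_on u v (f g : R -> R) (s A B : R) : u < v -> u <= s <= v ->
  (forall t, u <= t <= v -> f t = g t) -> is_derive f s A -> is_derive g s B -> A = B.
Proof.
  intros Huv Hs E Hf Hg.
  pose proof (is_derive_minusR _ _ _ _ _ Hf Hg) as H.
  apply is_derive_Reals in H.
  destruct (Req_dec A B) as [|N]; [easy|exfalso].
  assert (HN : 0 < Rabs (A - B)) by (apply Rabs_pos_lt; lra).
  destruct (H _ HN) as [[d Hd] Hlim]; simpl in Hlim.
  (* Half of [d] keeps the increment strictly within the radius; at s = v it points to the left. *)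
  assert (exists h, h <> 0 /\ Rabs h < d /\ u <= s + h <= v) as (h & h0 & hd & hs).
  { destruct (Rlt_dec s v).
    - exists (Rmin (d / 2) (v - s)).
      assert (0 < Rmin (d / 2) (v - s)) by (apply Rmin_pos; lra).
      pose proof (Rmin_l (d / 2) (v - s)); pose proof (Rmin_r (d / 2) (v - s)).
      split; [lra|split; [rewrite Rabs_right; lra|lra]].
    - exists (- Rmin (d / 2) (s - u)).
      assert (0 < Rmin (d / 2) (s - u)) by (apply Rmin_pos; lra).
      pose proof (Rmin_l (d / 2) (s - u)); pose proof (Rmin_r (d / 2) (s - u)).
      split; [lra|split; [rewrite Rabs_left; lra|lra]]. }
  specialize (Hlim h h0 hd). rewrite (E s Hs), (E (s + h) hs) in Hlim.
  replace ((g (s + h) - g (s + h) - (g s - g s)) / h - (A - B)) with (- (A - B)) in Hlim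
    by (field; exact h0).
  rewrite Rabs_Ropp in Hlim. lra.
Qed.

Lemma is_derive_0_constant u v (f : R -> R) : (forall s, u <= s <= v -> is_derive f s 0) ->
  forall s t, u <= s <= v -> u <= t <= v -> f s = f t.
Proof.
  intros H s t Hs Ht.
  destruct (MVT_gen f s t (fun _ => 0)) as (c & _ & Hc).
  - intros x Hx. apply H. unfold Rmin, Rmax in Hx. destruct (Rle_dec s t); lra.
  - intros x Hx. apply continuity_pt_filterlim, (is_derive_continuous _ _ 0), H.
    unfold Rmin, Rmax in Hx. destruct (Rle_dec s t); lra.
  - lra.
Qed.

Definition clamp (u v s : R) : R := Rmax u (Rmin s v).

Lemma clamp_in u v s : u <= v -> u <= clamp u v s <= v.
Proof. intros H. unfold clamp, Rmax, Rmin. repeat destruct Rle_dec; lra. Qed.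

Lemma clamp_id u v s : u <= s <= v -> clamp u v s = s.
Proof. intros H. unfold clamp, Rmax, Rmin. repeat destruct Rle_dec; lra. Qed.

Lemma clamp_lipschitz u v s t : u <= v -> Rabs (clamp u v s - clamp u v t) <= Rabs (s - t).
Proof.
  intros H. unfold clamp, Rmax, Rmin, Rabs. repeat destruct Rle_dec; repeat destruct Rcase_abs; lra.
Qed.

Lemma continuous_clamp u v s : u <= v -> continuous (clamp u v) s.
Proof.
  intros H. apply continuity_pt_filterlim. intros eps Heps.
  exists eps; split; [exact Heps|]. intros t [_ Ht]. simpl in *. unfold R_dist in *.
  eapply Rle_lt_trans; [now apply clamp_lipschitz | exact Ht].
Qed.

(* f may be discontinuous outside [u, v], whence the detour through clamp. *)
Lemma nonzero_same_sign u v (f : R -> R) :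
  (forall s, u <= s <= v -> continuous f s) -> (forall s, u <= s <= v -> f s <> 0) ->
  forall s t, u <= s <= v -> u <= t <= v -> 0 < f s -> 0 < f t.
Proof.
  intros Cf Nf s t Hs Ht P.
  destruct (Rlt_dec 0 (f t)) as [|N]; [easy|exfalso].
  assert (f t < 0) by (specialize (Nf t Ht); lra).
  assert (Huv : u <= v) by lra.
  destruct (IVT_gen (fun x => f (clamp u v x)) s t 0) as (x & _ & Hx).
  - intros x. apply continuity_pt_filterlim.
    apply (continuous_comp (clamp u v) f); [now apply continuous_clamp|].
    apply Cf. now apply clamp_in.
  - rewrite !clamp_id by easy. unfold Rmin, Rmax. repeat destruct Rle_dec; lra.
  - apply (Nf (clamp u v x)); [now apply clamp_in | exact Hx].
Qed.

(** * Vectors and space curves *)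

Definition vsub (u v : V3) : V3 := vadd u (vscal (-1) v).

Lemma V3_ext u v : x1 u = x1 v -> x2 u = x2 v -> x3 u = x3 v -> u = v.
Proof. destruct u, v; simpl; intros; subst; reflexivity. Qed.

Lemma vdot_pos u : 0 <= vdot u u.
Proof. unfold vdot. nra. Qed.

Lemma vdot_self_eq0 u : vdot u u = 0 -> u = mkV3 0 0 0.
Proof. intros H. unfold vdot in H. apply V3_ext; simpl; nra. Qed.

Lemma vdot_comm u v : vdot u v = vdot v u.
Proof. unfold vdot; ring. Qed.

Lemma vdot_vsub_l u v w : vdot (vsub u v) w = vdot u w - vdot v w.
Proof. unfold vdot, vsub, vadd, vscal; simpl; ring. Qed.

Lemma vdot_vscal_l k u v : vdot (vscal k u) v = k * vdot u v.
Proof. unfold vdot, vscal; simpl; ring. Qed.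

Lemma vdot_vadd_l u v w : vdot (vadd u v) w = vdot u w + vdot v w.
Proof. unfold vdot, vadd; simpl; ring. Qed.

(** Lagrange's identity; the Cauchy-Schwarz inequality follows because the left side is
    nonnegative. *)
Lemma vdot_vcross_self u v :
  vdot (vcross u v) (vcross u v) = vdot u u * vdot v v - vdot u v * vdot u v.
Proof. unfold vdot, vcross; simpl; ring. Qed.

Lemma vdot_cauchy_schwarz u v : vdot u v * vdot u v <= vdot u u * vdot v v.
Proof. pose proof (vdot_pos (vcross u v)) as H. rewrite vdot_vcross_self in H. lra. Qed.

Lemma vnorm_sqr u : vnorm u * vnorm u = vdot u u.
Proof. unfold vnorm. apply sqrt_sqrt, vdot_pos. Qed.

Lemma vnorm_pos u : 0 <= vnorm u.
Proof. apply sqrt_pos. Qed.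

Lemma vnorm_vscal k u : vnorm (vscal k u) = Rabs k * vnorm u.
Proof.
  unfold vnorm. replace (vdot (vscal k u) (vscal k u)) with (k * k * vdot u u)
    by (unfold vdot, vscal; simpl; ring).
  rewrite sqrt_mult; [|nra|apply vdot_pos]. now rewrite <- (sqrt_Rsqr_abs k).
Qed.

Lemma vcross_vscal h k u v : vcross (vscal h u) (vscal k v) = vscal (h * k) (vcross u v).
Proof. apply V3_ext; unfold vcross, vscal; simpl; ring. Qed.

Lemma vscal_vscal h k u : vscal h (vscal k u) = vscal (h * k) u.
Proof. apply V3_ext; unfold vscal; simpl; ring. Qed.

Lemma vscal_1 u : vscal 1 u = u.
Proof. apply V3_ext; unfold vscal; simpl; ring. Qed.

Definition vCk_at (n : nat) (c : R -> V3) (x : R) : Prop :=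
  Ck_at n (fun t => x1 (c t)) x /\ Ck_at n (fun t => x2 (c t)) x /\
  Ck_at n (fun t => x3 (c t)) x.

Lemma vsmooth_vCk_at n c x : vsmooth c -> vCk_at n c x.
Proof. intros (H1 & H2 & H3). repeat split; now apply smooth_fun_Ck_at. Qed.

Lemma vsmooth_vderiv c : vsmooth c -> vsmooth (vderiv c).
Proof. intros (H1 & H2 & H3). repeat split; now apply smooth_fun_Derive. Qed.

Lemma vsmooth_comp c f : vsmooth c -> smooth_fun f -> vsmooth (fun t => c (f t)).
Proof.
  intros (H1 & H2 & H3) Hf. split; [|split].
  - now apply (smooth_fun_comp (fun t => x1 (c t))).
  - now apply (smooth_fun_comp (fun t => x2 (c t))).
  - now apply (smooth_fun_comp (fun t => x3 (c t))).
Qed.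

Lemma vCk_at_vadd n c d x :
  vCk_at n c x -> vCk_at n d x -> vCk_at n (fun t => vadd (c t) (d t)) x.
Proof. intros (? & ? & ?) (? & ? & ?). repeat split; simpl; now apply Ck_at_plus. Qed.

Lemma vCk_at_vscal n f c x :
  Ck_at n f x -> vCk_at n c x -> vCk_at n (fun t => vscal (f t) (c t)) x.
Proof. intros ? (? & ? & ?). repeat split; simpl; now apply Ck_at_mult. Qed.

Lemma vCk_at_vcross n c d x :
  vCk_at n c x -> vCk_at n d x -> vCk_at n (fun t => vcross (c t) (d t)) x.
Proof.
  intros (? & ? & ?) (? & ? & ?).
  repeat split; simpl; apply Ck_at_minus; now apply Ck_at_mult.
Qed.

Lemma Ck_at_vdot n c d x :
  vCk_at n c x -> vCk_at n d x -> Ck_at n (fun t => vdot (c t) (d t)) x.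
Proof.
  intros (? & ? & ?) (? & ? & ?). unfold vdot.
  repeat apply Ck_at_plus; now apply Ck_at_mult.
Qed.

Lemma vCk_at_const n u x : vCk_at n (fun _ => u) x.
Proof. repeat split; apply Ck_at_const. Qed.

Lemma Ck_at_vnorm n c x : vCk_at n c x -> vnorm (c x) <> 0 -> Ck_at n (fun t => vnorm (c t)) x.
Proof.
  intros Hc Hx. unfold vnorm. apply Ck_at_sqrt; [now apply Ck_at_vdot|].
  rewrite <- vnorm_sqr. pose proof (vnorm_pos (c x)). nra.
Qed.

(** The vector c' x c'' shared by [curv], [tors] and [binormal]; at unit speed its length is the
    curvature. *)
Definition bivector (c : R -> V3) (s : R) : V3 := vcross (vderiv c s) (vderiv (vderiv c) s).

Lemma vCk_at_bivector n c x : vsmooth c -> vCk_at n (bivector c) x.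
Proof.
  intros Hc. apply (vCk_at_vcross n (vderiv c) (vderiv (vderiv c)) x); apply vsmooth_vCk_at.
  - exact (vsmooth_vderiv c Hc).
  - exact (vsmooth_vderiv _ (vsmooth_vderiv c Hc)).
Qed.

Lemma Ck_at_curv n c x : vsmooth c -> vnorm (vderiv c x) <> 0 ->
  vnorm (bivector c x) <> 0 -> Ck_at n (curv c) x.
Proof.
  intros Hc H1 H2. apply Ck_at_div.
  - apply Ck_at_vnorm; [now apply vCk_at_bivector | exact H2].
  - apply Ck_at_pow, Ck_at_vnorm; [now apply vsmooth_vCk_at, vsmooth_vderiv | exact H1].
  - now apply pow_nonzero.
Qed.

(** The nonvanishing quantities are the denominators in the Frenet frame and in [cotbeta]; the
    remaining one, 1 + cot^2, is always positive. *)
Lemma vCk_at_ruling n c alpha x : vsmooth c -> smooth_fun alpha ->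
  vnorm (vderiv c x) <> 0 -> vnorm (bivector c x) <> 0 -> sin (alpha x) <> 0 ->
  vCk_at n (ruling c alpha) x.
Proof.
  intros Hc Ha H1 H2 H3.
  pose proof (vsmooth_vderiv c Hc) as Hc1. pose proof (vsmooth_vderiv _ Hc1) as Hc2.
  pose proof (vsmooth_vderiv _ Hc2) as Hc3.
  assert (C1 : vCk_at n (vderiv c) x) by now apply vsmooth_vCk_at.
  assert (C3 : vCk_at n (vderiv (vderiv (vderiv c))) x) by now apply vsmooth_vCk_at.
  pose proof (vCk_at_bivector n c x Hc) as CB.
  pose proof (Ck_at_vnorm n _ x C1 H1) as CN1.
  pose proof (Ck_at_vnorm n _ x CB H2) as CNB.
  assert (CK : Ck_at n (curv c) x) by now apply Ck_at_curv.
  assert (CA : Ck_at n alpha x) by now apply smooth_fun_Ck_at.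
  assert (CT : Ck_at n (tors c) x).
  { apply Ck_at_div; [now apply Ck_at_vdot | now apply Ck_at_pow | now apply pow_nonzero]. }
  assert (K0 : curv c x <> 0).
  { unfold curv. apply Rmult_integral_contrapositive; split; [exact H2|].
    now apply Rinv_neq_0_compat, pow_nonzero. }
  assert (CC : Ck_at n (cotbeta c alpha) x).
  { apply Ck_at_div.
    - apply Ck_at_plus; [now apply smooth_fun_Ck_at, smooth_fun_Derive | now apply Ck_at_mult].
    - apply Ck_at_mult; [now apply Ck_at_mult | now apply Ck_at_sin].
    - apply Rmult_integral_contrapositive_currified; [|exact H3].
      now apply Rmult_integral_contrapositive_currified. }
  assert (CTan : vCk_at n (tangent c) x).
  { apply vCk_at_vscal; [now apply Ck_at_inv | exact C1]. }
  assert (CBin : vCk_at n (binormal c) x).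
  { apply vCk_at_vscal; [now apply Ck_at_inv | exact CB]. }
  assert (CNor : vCk_at n (normal c) x) by now apply vCk_at_vcross.
  assert (P : 0 < 1 + cotbeta c alpha x ^ 2) by (pose proof (pow2_ge_0 (cotbeta c alpha x)); lra).
  apply vCk_at_vscal.
  - apply Ck_at_inv.
    + apply Ck_at_sqrt; [|exact P].
      apply Ck_at_plus; [apply Ck_at_const | now apply Ck_at_pow].
    + apply Rgt_not_eq. now apply sqrt_lt_R0.
  - apply vCk_at_vadd; [now apply vCk_at_vscal|].
    apply vCk_at_vadd; apply vCk_at_vscal; trivial; [now apply Ck_at_cos | now apply Ck_at_sin].
Qed.

(** * Dependence of the origami image on its data *)

Lemma vderiv_eq_on u v c d : u < v -> vsmooth c -> vsmooth d ->
  (forall s, u <= s <= v -> c s = d s) ->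
  forall s, u <= s <= v -> vderiv c s = vderiv d s.
Proof.
  intros Huv (C1 & C2 & C3) (D1 & D2 & D3) E s Hs.
  apply V3_ext; simpl.
  - apply (is_derive_unique_on u v (fun t => x1 (c t)) (fun t => x1 (d t)) s); trivial;
      [|now apply smooth_fun_is_derive..]. intros t Ht. now rewrite E.
  - apply (is_derive_unique_on u v (fun t => x2 (c t)) (fun t => x2 (d t)) s); trivial;
      [|now apply smooth_fun_is_derive..]. intros t Ht. now rewrite E.
  - apply (is_derive_unique_on u v (fun t => x3 (c t)) (fun t => x3 (d t)) s); trivial;
      [|now apply smooth_fun_is_derive..]. intros t Ht. now rewrite E.
Qed.

(** The ruling involves three derivatives of the curve and one of the angle; on a nondegenerate
    closed interval all of them are determined by the values there, end points included. *)
Lemma ruling_eq_on u v c d alpha beta : u < v -> vsmooth c -> vsmooth d ->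
  smooth_fun alpha -> smooth_fun beta ->
  (forall s, u <= s <= v -> c s = d s) -> (forall s, u <= s <= v -> alpha s = beta s) ->
  forall s, u <= s <= v -> ruling c alpha s = ruling d beta s.
Proof.
  intros Huv Hc Hd Ha Hb Ec Ea s Hs.
  pose proof (vsmooth_vderiv c Hc) as Hc1. pose proof (vsmooth_vderiv _ Hc1) as Hc2.
  pose proof (vsmooth_vderiv d Hd) as Hd1. pose proof (vsmooth_vderiv _ Hd1) as Hd2.
  pose proof (vderiv_eq_on u v c d Huv Hc Hd Ec) as E1.
  pose proof (vderiv_eq_on u v _ _ Huv Hc1 Hd1 E1) as E2.
  pose proof (vderiv_eq_on u v _ _ Huv Hc2 Hd2 E2) as E3.
  assert (EA : Derive alpha s = Derive beta s).
  { apply (is_derive_unique_on u v alpha beta s); trivial; now apply smooth_fun_is_derive. }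
  unfold ruling, cotbeta, normal, binormal, tangent, curv, tors.
  now rewrite (E1 s Hs), (E2 s Hs), (E3 s Hs), (Ea s Hs), EA.
Qed.

Lemma origami_image_eq_on l c d alpha beta : 0 < l -> vsmooth c -> vsmooth d ->
  smooth_fun alpha -> smooth_fun beta ->
  (forall s, inJ l s -> c s = d s) -> (forall s, inJ l s -> alpha s = beta s) ->
  origami_image l c alpha = origami_image l d beta.
Proof.
  intros Hl Hc Hd Ha Hb Ec Ea. unfold inJ in *.
  assert (Hu : - (l / 2) < l / 2) by lra.
  assert (E : forall s v, inJ l s -> origami c alpha s v = origami d beta s v).
  { intros s v Hs. unfold origami, strip. rewrite (Ec s Hs).
    destruct (Rle_dec 0 v).
    - now rewrite (ruling_eq_on _ _ c d alpha beta Hu Hc Hd Ha Hb Ec Ea s Hs).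
    - rewrite (ruling_eq_on _ _ c d (fun t => - alpha t) (fun t => - beta t) Hu Hc Hd
                 (smooth_fun_opp _ Ha) (smooth_fun_opp _ Hb) Ec); trivial.
      intros t Ht. now rewrite Ea. }
  apply functional_extensionality; intros e. apply functional_extensionality; intros p.
  apply propositional_extensionality. unfold origami_image.
  split; intros (s & v & Hs & Hv & Hp); exists s, v; repeat split; try (apply Hs || apply Hv).
  - now rewrite <- (E s v Hs).
  - now rewrite (E s v Hs).
Qed.

Lemma Derive_reflect f (s : R) : smooth_fun f -> Derive (fun t => f (- t)) s = - Derive f (- s).
Proof. intros Hf. apply is_derive_unique, is_derive_reflect. now apply smooth_fun_is_derive. Qed.

(** The scalar [k] lets the rule be iterated: each differentiation only changes its sign. *)
Lemma vderiv_vscal_reflect k c : vsmooth c ->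
  vderiv (fun t => vscal k (c (- t))) = fun s => vscal (- k) (vderiv c (- s)).
Proof.
  intros (C1 & C2 & C3). apply functional_extensionality; intros s.
  assert (A : forall f, smooth_fun f -> Derive (fun t => k * f (- t)) s = - k * Derive f (- s)).
  { intros f Hf. rewrite Derive_scal.
    rewrite (Derive_reflect f s Hf). ring. }
  apply V3_ext; simpl.
  - apply (A (fun t => x1 (c t)) C1).
  - apply (A (fun t => x2 (c t)) C2).
  - apply (A (fun t => x3 (c t)) C3).
Qed.

Lemma vderiv_reflect c : vsmooth c ->
  vderiv (fun t => c (- t)) = fun s => vscal (-1) (vderiv c (- s)).
Proof.
  intros Hc. replace (-1) with (- (1)) by ring.
  rewrite <- (vderiv_vscal_reflect 1 c Hc). f_equal.
  apply functional_extensionality; intros t. now rewrite vscal_1.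
Qed.

Lemma vderiv2_reflect c : vsmooth c ->
  vderiv (vderiv (fun t => c (- t))) = fun s => vscal 1 (vderiv (vderiv c) (- s)).
Proof.
  intros Hc. rewrite (vderiv_reflect c Hc), (vderiv_vscal_reflect (-1) _ (vsmooth_vderiv c Hc)).
  now replace (- -1) with 1 by ring.
Qed.

Lemma curv_reflect c s : vsmooth c -> curv (fun t => c (- t)) s = curv c (- s).
Proof.
  intros Hc. unfold curv. rewrite (vderiv2_reflect c Hc), (vderiv_reflect c Hc).
  rewrite vcross_vscal, !vnorm_vscal.
  replace (Rabs (-1 * 1)) with 1 by (rewrite Rabs_left; lra).
  replace (Rabs (-1)) with 1 by (rewrite Rabs_left; lra).
  now rewrite !Rmult_1_l.
Qed.

(* Reversing the orientation sends (e, n, b) to (-e, n, -b) and cot beta to its opposite. *)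
Lemma ruling_reflect c alpha s : vsmooth c -> smooth_fun alpha ->
  ruling (fun t => c (- t)) (fun t => - alpha (- t)) s = ruling c alpha (- s).
Proof.
  intros Hc Ha.
  pose proof (vderiv_reflect c Hc) as E1. pose proof (vderiv2_reflect c Hc) as E2.
  assert (E3 : vderiv (vderiv (vderiv (fun t => c (- t)))) =
               fun s => vscal (-1) (vderiv (vderiv (vderiv c)) (- s))).
  { rewrite E2, (vderiv_vscal_reflect 1 _ (vsmooth_vderiv _ (vsmooth_vderiv c Hc))).
    now replace (- (1)) with (-1) by ring. }
  assert (EA : Derive (fun t => - alpha (- t)) s = Derive alpha (- s)).
  { rewrite Derive_opp, (Derive_reflect alpha s Ha). ring. }
  unfold ruling, cotbeta, normal, binormal, tangent, curv, tors.
  rewrite E3, E2, E1, EA.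
  set (C1 := vderiv c (- s)). set (C2 := vderiv (vderiv c) (- s)).
  set (C3 := vderiv (vderiv (vderiv c)) (- s)).
  rewrite vcross_vscal, !vnorm_vscal.
  replace (Rabs (-1 * 1)) with 1 by (rewrite Rabs_left; lra).
  replace (Rabs (-1)) with 1 by (rewrite Rabs_left; lra).
  rewrite !Rmult_1_l, sin_neg, cos_neg, !vscal_vscal.
  replace (vdot (vscal (-1 * 1) (vcross C1 C2)) (vscal (-1) C3)) with (vdot (vcross C1 C2) C3)
    by (unfold vdot, vscal; simpl; ring).
  set (B := vcross C1 C2). set (t := vdot B C3 / vnorm B ^ 2).
  set (q := (Derive alpha (- s) + vnorm C1 * t)).
  replace (q / (vnorm C1 * (vnorm B / vnorm C1 ^ 3) * - sin (alpha (- s))))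
    with (- (q / (vnorm C1 * (vnorm B / vnorm C1 ^ 3) * sin (alpha (- s))))).
  2: { unfold Rdiv. rewrite <- Ropp_mult_distr_r, Rinv_opp. ring. }
  set (w := q / (vnorm C1 * (vnorm B / vnorm C1 ^ 3) * sin (alpha (- s)))).
  replace ((- w) ^ 2) with (w ^ 2) by ring.
  f_equal. apply V3_ext; unfold vadd, vscal, vcross; simpl; ring.
Qed.

Lemma origami_image_reflect l c alpha : vsmooth c -> smooth_fun alpha ->
  origami_image l (fun t => c (- t)) (fun t => - alpha (- t)) = origami_image l c alpha.
Proof.
  intros Hc Ha.
  (* On the sheet v < 0 the negated angle is the reflection of [- alpha], so the same rule serves
     both sheets; [v] itself is unchanged. *)
  assert (E : forall s v, origami (fun t => c (- t)) (fun t => - alpha (- t)) s v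
                          = origami c alpha (- s) v).
  { intros s v. unfold origami, strip. rewrite (ruling_reflect c alpha s Hc Ha).
    now rewrite (ruling_reflect c (fun t => - alpha t) s Hc (smooth_fun_opp _ Ha)). }
  apply functional_extensionality; intros e. apply functional_extensionality; intros p.
  apply propositional_extensionality. unfold origami_image, inJ.
  split; intros (s & v & Hs & Hv & Hp); exists (- s), v; (split; [lra|split; [exact Hv|]]).
  - now rewrite <- E.
  - now rewrite E, Ropp_involutive.
Qed.

(** * The germ determines the first angular function *)

Record orthonormal (e n b : V3) : Prop := {
  on_ee : vdot e e = 1; on_nn : vdot n n = 1; on_bb : vdot b b = 1;
  on_en : vdot e n = 0; on_eb : vdot e b = 0; on_nb : vdot n b = 0 }.

Lemma bivector_norm_curv c s : vnorm (vderiv c s) = 1 -> vnorm (bivector c s) = curv c s.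
Proof. intros H. unfold curv, bivector. rewrite H. field. Qed.

Lemma tangent_unit_speed c s : vnorm (vderiv c s) = 1 -> tangent c s = vderiv c s.
Proof. intros H. unfold tangent. rewrite H, Rinv_1. apply vscal_1. Qed.

Lemma frenet_orthonormal c s : vnorm (vderiv c s) = 1 -> 0 < curv c s ->
  orthonormal (tangent c s) (normal c s) (binormal c s).
Proof.
  intros H1 HK. pose proof (bivector_norm_curv c s H1) as HB.
  assert (EE : vdot (tangent c s) (tangent c s) = 1).
  { rewrite tangent_unit_speed by exact H1. rewrite <- vnorm_sqr, H1. ring. }
  assert (BB : vdot (binormal c s) (binormal c s) = 1).
  { unfold binormal. fold (bivector c s).
    rewrite vdot_vscal_l, vdot_comm, vdot_vscal_l, <- vnorm_sqr, HB. field. lra. }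
  assert (EB : vdot (tangent c s) (binormal c s) = 0).
  { rewrite tangent_unit_speed by exact H1. unfold binormal. rewrite vdot_comm, vdot_vscal_l.
    unfold vdot, vcross; simpl; ring. }
  split; trivial.
  - unfold normal. rewrite vdot_vcross_self, EE, BB, (vdot_comm (binormal c s)), EB. ring.
  - unfold normal, vdot, vcross; simpl; ring.
  - unfold normal, vdot, vcross; simpl; ring.
Qed.

Definition sinbeta (c : R -> V3) (alpha : R -> R) (s : R) : R :=
  / sqrt (1 + cotbeta c alpha s ^ 2).

Lemma sinbeta_pos c alpha s : 0 < sinbeta c alpha s.
Proof.
  apply Rinv_0_lt_compat, sqrt_lt_R0. pose proof (pow2_ge_0 (cotbeta c alpha s)); lra.
Qed.

Lemma ruling_vdot c alpha s m :
  vdot (ruling c alpha s) m =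
  sinbeta c alpha s * (cotbeta c alpha s * vdot (tangent c s) m
    + cos (alpha s) * vdot (normal c s) m + sin (alpha s) * vdot (binormal c s) m).
Proof. unfold ruling, sinbeta. rewrite vdot_vscal_l, !vdot_vadd_l, !vdot_vscal_l. ring. Qed.

Lemma ruling_vdot_normal c alpha s : vnorm (vderiv c s) = 1 -> 0 < curv c s ->
  vdot (ruling c alpha s) (normal c s) = sinbeta c alpha s * cos (alpha s).
Proof.
  intros H1 H2. destruct (frenet_orthonormal c s H1 H2) as [_ NN _ EN _ NB].
  rewrite ruling_vdot, NN, EN, (vdot_comm (binormal c s)), NB. ring.
Qed.

Lemma ruling_vdot_binormal c alpha s : vnorm (vderiv c s) = 1 -> 0 < curv c s ->
  vdot (ruling c alpha s) (binormal c s) = sinbeta c alpha s * sin (alpha s).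
Proof.
  intros H1 H2. destruct (frenet_orthonormal c s H1 H2) as [_ _ BB _ EB NB].
  rewrite ruling_vdot, BB, EB, NB. ring.
Qed.

Lemma ruling_unit c alpha s : vnorm (vderiv c s) = 1 -> 0 < curv c s ->
  vdot (ruling c alpha s) (ruling c alpha s) = 1.
Proof.
  intros H1 H2. destruct (frenet_orthonormal c s H1 H2) as [EE _ _ EN EB _].
  rewrite ruling_vdot, !(vdot_comm _ (ruling c alpha s)).
  rewrite ruling_vdot_normal, ruling_vdot_binormal by easy.
  rewrite (ruling_vdot c alpha s (tangent c s)), EE, (vdot_comm (normal c s)), EN.
  rewrite (vdot_comm (binormal c s)), EB.
  pose proof (sin2_cos2 (alpha s)) as SC. unfold Rsqr in SC.
  set (r := sinbeta c alpha s) in *. set (q := cotbeta c alpha s).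
  assert (P : 0 < 1 + q ^ 2) by (pose proof (pow2_ge_0 q); lra).
  replace (r * _) with
    (r * r * (q ^ 2 + (sin (alpha s) * sin (alpha s) + cos (alpha s) * cos (alpha s)))) by ring.
  rewrite SC. unfold r, sinbeta. fold q.
  rewrite <- Rinv_mult, sqrt_sqrt by lra. field. lra.
Qed.

(** Differentiability without a quotient, hence valid also at y = x. *)
Lemma is_derive_linear_approx (f : R -> R) (x a eps : R) : is_derive f x a -> 0 < eps ->
  locally x (fun y => Rabs (f y - f x - a * (y - x)) <= eps * Rabs (y - x)).
Proof.
  intros H Heps. apply is_derive_Reals in H. destruct (H eps Heps) as [d Hd].
  exists d. enough (A : forall y : R, Rabs (y - x) < d ->
    Rabs (f y - f x - a * (y - x)) <= eps * Rabs (y - x)) by exact A.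
  intros y Hy.
  destruct (Req_dec y x) as [->|N].
  - rewrite !Rminus_diag, Rmult_0_r, Rminus_0_r, Rabs_R0. lra.
  - specialize (Hd (y - x) ltac:(lra) Hy). replace (x + (y - x)) with y in Hd by ring.
    replace (f y - f x - a * (y - x)) with (((f y - f x) / (y - x) - a) * (y - x))
      by (field; lra).
    rewrite Rabs_mult. apply Rmult_le_compat_r; [apply Rabs_pos | lra].
Qed.

Lemma positive_lower_bound u v (f : R -> R) : (forall s, u <= s <= v -> continuous f s) ->
  (forall s, u <= s <= v -> 0 < f s) -> exists m, 0 < m /\ forall s, u <= s <= v -> m <= f s.
Proof.
  intros Cf Pf. destruct (Rle_dec u v) as [H|H].
  - destruct (continuity_ab_min f u v H) as (x & Hx & Hi).
    + intros s Hs. now apply continuity_pt_filterlim, Cf.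
    + exists (f x); split; [now apply Pf | exact Hx].
  (* The interval is empty here, so any positive bound serves. *)
  - exists 1; split; [lra|]. intros; lra.
Qed.

(** By compactness the squared distance to c(s0) has a positive lower bound on the parameters at
    distance at least [eps] from s0. These form two intervals, either of which may be empty. *)
Lemma injective_curve_inverse_continuous u v c s0 eps :
  (forall s, u <= s <= v -> vCk_at 0 c s) ->
  (forall s t, u <= s <= v -> u <= t <= v -> c s = c t -> s = t) ->
  u <= s0 <= v -> 0 < eps ->
  exists eta, 0 < eta /\ forall s, u <= s <= v ->
    vdot (vsub (c s) (c s0)) (vsub (c s) (c s0)) < eta -> Rabs (s - s0) < eps.
Proof.
  intros Cc Hi Hs0 Heps.
  set (f := fun s => vdot (vsub (c s) (c s0)) (vsub (c s) (c s0))).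
  assert (Cf : forall s, u <= s <= v -> continuous f s).
  { intros s Hs. assert (vCk_at 0 (fun t => vsub (c t) (c s0)) s).
    { apply vCk_at_vadd; [now apply Cc | apply vCk_at_const]. }
    now apply (Ck_at_vdot 0 _ _ s). }
  assert (Pf : forall s, u <= s <= v -> s <> s0 -> 0 < f s).
  { intros s Hs Hn. destruct (vdot_pos (vsub (c s) (c s0))) as [|E]; [easy|exfalso].
    symmetry in E. apply vdot_self_eq0 in E. apply Hn, Hi; trivial.
    unfold vsub, vadd, vscal in E. injection E as E1 E2 E3. apply V3_ext; lra. }
  destruct (positive_lower_bound u (s0 - eps) f) as (m1 & P1 & B1).
  { intros s Hs. apply Cf; lra. } { intros s Hs. apply Pf; lra. }
  destruct (positive_lower_bound (s0 + eps) v f) as (m2 & P2 & B2).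
  { intros s Hs. apply Cf; lra. } { intros s Hs. apply Pf; lra. }
  exists (Rmin m1 m2); split; [now apply Rmin_pos|]. intros s Hs Hlt. fold (f s) in Hlt.
  pose proof (Rmin_l m1 m2); pose proof (Rmin_r m1 m2).
  apply Rabs_def1; apply Rnot_le_lt; intros Hc.
  - specialize (B2 s ltac:(lra)). lra.
  - specialize (B1 s ltac:(lra)). lra.
Qed.

Lemma is_derive_vdot_const c s m : vsmooth c ->
  is_derive (fun t => vdot (c t) m) s (vdot (vderiv c s) m).
Proof.
  intros (C1 & C2 & C3). unfold vdot, vderiv; simpl.
  repeat apply is_derive_plusR.
  - eapply is_derive_eq; [apply is_derive_multR;
      [apply (smooth_fun_is_derive _ s C1)|apply (is_derive_const (x1 m) s)]|].
    unfold zero; simpl; ring.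
  - eapply is_derive_eq; [apply is_derive_multR;
      [apply (smooth_fun_is_derive _ s C2)|apply (is_derive_const (x2 m) s)]|].
    unfold zero; simpl; ring.
  - eapply is_derive_eq; [apply is_derive_multR;
      [apply (smooth_fun_is_derive _ s C3)|apply (is_derive_const (x3 m) s)]|].
    unfold zero; simpl; ring.
Qed.

Definition angular (l : R) (alpha : R -> R) : Prop :=
  forall s, inJ l s -> - (PI / 2) < alpha s < PI / 2 /\ alpha s <> 0.

Lemma angular_sin l alpha s : angular l alpha -> inJ l s -> sin (alpha s) <> 0.
Proof.
  intros H Hs. destruct (H s Hs) as [[A B] N]. pose proof PI_RGT_0.
  destruct (Rtotal_order (alpha s) 0) as [C|[C|C]]; [|easy|].
  - apply Rlt_not_eq, sin_lt_0_var; lra.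
  - apply Rgt_not_eq, sin_gt_0; lra.
Qed.

Lemma angular_cos l alpha s : angular l alpha -> inJ l s -> 0 < cos (alpha s).
Proof. intros H Hs. destruct (H s Hs) as [[A B] N]. now apply cos_gt_0. Qed.

Lemma angular_opp l alpha : angular l alpha -> angular l (fun t => - alpha t).
Proof. intros H s Hs. destruct (H s Hs) as [[A B] N]. split; [lra|]. intros E; apply N; lra. Qed.

Section GermInjectivity.
Variables (l : R) (c : R -> V3).
Hypothesis c_smooth : vsmooth c.
Hypothesis c_unit : forall s, inJ l s -> vnorm (vderiv c s) = 1.
Hypothesis c_curv : forall s, inJ l s -> 0 < curv c s.
Hypothesis c_inj : forall s t, inJ l s -> inJ l t -> c s = c t -> s = t.

Lemma ruling_locally_close alpha s0 m eps : smooth_fun alpha -> angular l alpha ->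
  inJ l s0 -> 0 < eps ->
  locally s0 (fun s => Rabs (vdot (ruling c alpha s) m - vdot (ruling c alpha s0) m) < eps).
Proof.
  intros Ha Aa Hs He.
  assert (C : Ck_at 0 (fun s => vdot (ruling c alpha s) m) s0).
  { apply Ck_at_vdot; [|apply vCk_at_const].
    apply vCk_at_ruling; trivial.
    - rewrite c_unit by easy. lra.
    - rewrite bivector_norm_curv by now apply c_unit.
      pose proof (c_curv s0 Hs); lra.
    - now apply (angular_sin l). }
  exact (C _ (locally_ball _ (mkposreal eps He))).
Qed.

(* The point at height v on the ruling through c s0 lies on the other image, on a ruling
   through some c s with |s - s0| = O(v); normally to the curve, c s - c s0 = o(v), so the two
   rulings agree up to a factor w / v and a small error. *)
Lemma germ_rulings_close alpha1 alpha2 s0 eps :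
  smooth_fun alpha1 -> smooth_fun alpha2 -> angular l alpha1 -> angular l alpha2 ->
  (exists e0, 0 < e0 /\ forall e, 0 < e < e0 -> forall p,
     origami_image l c alpha1 e p -> origami_image l c alpha2 e p) ->
  inJ l s0 -> 0 < eps ->
  exists k beta, (0 <= k /\ beta = alpha2 \/ k < 0 /\ beta = fun t => - alpha2 t) /\
    forall m, m = normal c s0 \/ m = binormal c s0 ->
      Rabs (vdot (ruling c alpha1 s0) m - k * vdot (ruling c beta s0) m) <= eps.
Proof.
  intros S1 S2 A1 A2 (e0 & He0 & Him) Hs0 Heps.
  pose proof (c_unit s0 Hs0) as U0. pose proof (c_curv s0 Hs0) as K0.
  destruct (frenet_orthonormal c s0 U0 K0) as [EE NN BB EN EB NB].
  set (E0 := tangent c s0) in *. set (N0 := normal c s0) in *. set (B0 := binormal c s0) in *.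
  assert (HE : vderiv c s0 = E0) by (symmetry; now apply tangent_unit_speed).
  (* The final error is 6 d from the curve plus 2 d from the turning of the ruling. *)
  set (d := eps / 8). assert (Hd : 0 < d) by (unfold d; lra).
  (* With tolerance 1/2 the tangential component of c(s) - c(s0) has size at least |s - s0| / 2. The
     normal and binormal components have derivative 0 at s0 and are at most d |s - s0|. *)
  pose proof (is_derive_linear_approx _ _ _ _ (is_derive_vdot_const c s0 E0 c_smooth)
                (ltac:(lra) : 0 < / 2)) as L1.
  pose proof (is_derive_linear_approx _ _ _ _ (is_derive_vdot_const c s0 N0 c_smooth) Hd) as L2.
  pose proof (is_derive_linear_approx _ _ _ _ (is_derive_vdot_const c s0 B0 c_smooth) Hd) as L3.
  rewrite HE in L1, L2, L3.
  pose proof (smooth_fun_opp _ S2) as S2'. pose proof (angular_opp _ _ A2) as A2'.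
  pose proof (ruling_locally_close _ s0 N0 d S2 A2 Hs0 Hd) as L4.
  pose proof (ruling_locally_close _ s0 B0 d S2 A2 Hs0 Hd) as L5.
  pose proof (ruling_locally_close _ s0 N0 d S2' A2' Hs0 Hd) as L6.
  pose proof (ruling_locally_close _ s0 B0 d S2' A2' Hs0 Hd) as L7.
  destruct (filter_and _ _ L1 (filter_and _ _ (filter_and _ _ L2 L3)
    (filter_and _ _ (filter_and _ _ L4 L5) (filter_and _ _ L6 L7)))) as [[r Hr] HL].
  clear L1 L2 L3 L4 L5 L6 L7.
  destruct (injective_curve_inverse_continuous (- (l / 2)) (l / 2) c s0 r) as (eta & Heta & Hinv);
    trivial. { intros s _. now apply vsmooth_vCk_at. }
  (* [2 * v] stays below [e0], and 9 v^2 < eta because v <= 1/4 and v <= eta / 4. *)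
  set (v := Rmin (e0 / 4) (Rmin 1 eta / 4)).
  assert (Hm : 0 < Rmin 1 eta) by (apply Rmin_pos; lra).
  assert (Hv : 0 < v) by (apply Rmin_pos; lra).
  assert (Hv1 : v <= e0 / 4) by apply Rmin_l.
  assert (Hv2 : v <= Rmin 1 eta / 4) by apply Rmin_r.
  pose proof (Rmin_l 1 eta); pose proof (Rmin_r 1 eta).
  assert (Hv3 : 9 * v * v < eta) by nra.
  (* Width [2 * v] strictly contains the height [v] and yields |w| < 2 v, so that |c(s) - c(s0)| <=
     3 v. *)
  destruct (Him (2 * v) ltac:(lra) (origami c alpha1 s0 v)) as (s & w & Hs & Hw & Ep).
  { exists s0, v. repeat split; try apply Hs0; lra. }
  assert (exists beta, (0 <= w /\ beta = alpha2 \/ w < 0 /\ beta = fun t => - alpha2 t) /\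
            origami c alpha2 s w = strip c beta s w) as (beta & Hb & Es).
  { unfold origami. destruct (Rle_dec 0 w).
    - exists alpha2. split; [left; now split | easy].
    - exists (fun t => - alpha2 t). split; [right; split; [lra | easy] | easy]. }
  rewrite Es in Ep. unfold origami in Ep. destruct (Rle_dec 0 v); [|lra]. clear Es.
  unfold strip in Ep.
  set (X1 := ruling c alpha1 s0) in *. set (X2 := ruling c beta s) in *.
  assert (D : vsub (c s) (c s0) = vsub (vscal v X1) (vscal w X2)).
  { unfold vadd, vscal in Ep. injection Ep as P1 P2 P3.
    apply V3_ext; unfold vsub, vadd, vscal; simpl; lra. }
  pose proof (ruling_unit c alpha1 s0 U0 K0) as N1. fold X1 in N1.
  pose proof (ruling_unit c beta s (c_unit s Hs) (c_curv s Hs)) as N2. fold X2 in N2.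
  pose proof (vdot_cauchy_schwarz X1 X2) as CS. rewrite N1, N2 in CS.
  assert (Dn : vdot (vsub (c s) (c s0)) (vsub (c s) (c s0)) <= 9 * v * v).
  { rewrite D. replace (vdot _ _) with
      (v * v * vdot X1 X1 - 2 * (v * w) * vdot X1 X2 + w * w * vdot X2 X2)
      by (unfold vdot, vsub, vadd, vscal; simpl; ring).
    rewrite N1, N2. set (z := vdot X1 X2) in *. assert (-1 <= z <= 1) by nra.
    assert (w * w <= 4 * v * v) by nra.
    assert (-(2 * v * v) <= v * w <= 2 * v * v) by nra. nra. }
  assert (Hr' : Rabs (s - s0) < r) by (apply Hinv; [exact Hs|lra]).
  destruct (HL s Hr') as (M1 & (M2 & M3) & (M4 & M5) & (M6 & M7)). clear HL.
  rewrite EE in M1. rewrite EN in M2. rewrite EB in M3.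
  assert (Hss : Rabs (s - s0) <= 6 * v).
  { rewrite <- vdot_vsub_l in M1.
    pose proof (vdot_cauchy_schwarz (vsub (c s) (c s0)) E0) as CE. rewrite EE in CE.
    set (z := vdot (vsub (c s) (c s0)) E0) in *.
    assert (-(3 * v) <= z <= 3 * v) by nra.
    revert M1. unfold Rabs. repeat destruct Rcase_abs; lra. }
  exists (w / v), beta. split.
  { destruct Hb as [[Hb Eb]|[Hb Eb]]; [left|right]; split; trivial.
    - apply Rmult_le_pos; [lra|]. apply Rlt_le, Rinv_0_lt_compat; lra.
    - unfold Rdiv. pose proof (Rinv_0_lt_compat v Hv). nra. }
  (* For [m] orthogonal to the tangent, X1 and (w / v) X2 have almost the same component along [m];
     X2 is then replaced by the ruling of [beta] at s0, at the cost |w| d before division by v. *)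
  assert (Main : forall m,
    Rabs (vdot (c s) m - vdot (c s0) m - 0 * (s - s0)) <= d * Rabs (s - s0) ->
    Rabs (vdot X2 m - vdot (ruling c beta s0) m) < d ->
    Rabs (vdot X1 m - w / v * vdot (ruling c beta s0) m) <= eps).
  { intros m Q1 Q2. rewrite <- vdot_vsub_l, D, vdot_vsub_l, !vdot_vscal_l in Q1.
    set (z1 := vdot X1 m) in *. set (z2 := vdot X2 m) in *.
    set (z3 := vdot (ruling c beta s0) m) in *.
    replace (z1 - w / v * z3) with ((v * z1 - w * z2 - 0 * (s - s0) + w * (z2 - z3)) / v)
      by (field; lra).
    unfold Rdiv. rewrite Rabs_mult, Rabs_inv, (Rabs_right v) by lra.
    apply (Rmult_le_reg_r v); [exact Hv|]. rewrite Rmult_assoc, Rinv_l, Rmult_1_r by lra.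
    eapply Rle_trans; [apply Rabs_triang|]. rewrite (Rabs_mult w).
    assert (Rabs w <= 2 * v) by (apply Rabs_le; lra).
    pose proof (Rabs_pos w). pose proof (Rabs_pos (z2 - z3)).
    assert (d * Rabs (s - s0) <= d * (6 * v)) by (apply Rmult_le_compat_l; lra).
    assert (Rabs w * Rabs (z2 - z3) <= (2 * v) * d) by (apply Rmult_le_compat; lra).
    replace eps with (8 * d) by (unfold d; field). lra. }
  intros m Hmm. apply Main; destruct Hmm as [-> | ->]; trivial;
    destruct Hb as [[_ ->]|[_ ->]]; trivial.
Qed.

(** In the normal plane the first ruling is nearly k times the second. The factor [k] varies with
    [eps] but cancels in the determinant of the two projections, which is the product of the sines
    of both second angles and of sin(alpha1 - alpha2). So this determinant vanishes, and the angles
    differ by less than pi. *)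
Lemma germ_determines_angle alpha1 alpha2 s0 :
  smooth_fun alpha1 -> smooth_fun alpha2 -> angular l alpha1 -> angular l alpha2 ->
  (exists e0, 0 < e0 /\ forall e, 0 < e < e0 -> forall p,
     origami_image l c alpha1 e p -> origami_image l c alpha2 e p) ->
  inJ l s0 -> alpha1 s0 = alpha2 s0.
Proof.
  intros S1 S2 A1 A2 Him Hs0.
  pose proof (c_unit s0 Hs0) as U0. pose proof (c_curv s0 Hs0) as K0.
  pose proof (angular_cos _ _ _ A1 Hs0) as P1. pose proof (angular_cos _ _ _ A2 Hs0) as P2.
  pose proof (sinbeta_pos c alpha1 s0) as R1. pose proof (sinbeta_pos c alpha2 s0) as R2.
  set (r1 := sinbeta c alpha1 s0) in *. set (r2 := sinbeta c alpha2 s0) in *.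
  assert (Q1 : 0 < r1 * cos (alpha1 s0)) by nra.
  assert (Z : r1 * r2 * sin (alpha1 s0 - alpha2 s0) = 0).
  { rewrite sin_minus. set (z := r1 * r2 * _). apply NNPP; intros Nz.
    pose proof (Rabs_pos_lt _ Nz) as Pz.
    set (M := Rabs (r2 * cos (alpha2 s0)) + Rabs (r2 * sin (alpha2 s0)) + 1).
    assert (HM : 0 < M).
    { pose proof (Rabs_pos (r2 * cos (alpha2 s0))).
      pose proof (Rabs_pos (r2 * sin (alpha2 s0))). unfold M; lra. }
    (* The first bound excludes the dual sheet, the second forces |z| <= |z| / 2. The 1 in [M] keeps
       it positive. *)
    set (eps := Rmin (r1 * cos (alpha1 s0) / 2) (Rabs z / (2 * M))).
    assert (He : 0 < eps).
    { apply Rmin_pos; [lra|]. apply Rdiv_lt_0_compat; lra. }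
    destruct (germ_rulings_close alpha1 alpha2 s0 eps S1 S2 A1 A2 Him Hs0 He)
      as (k & beta & Hk & Hc).
    pose proof (Hc _ (or_introl eq_refl)) as HN. pose proof (Hc _ (or_intror eq_refl)) as HB.
    rewrite !ruling_vdot_normal in HN by easy. rewrite !ruling_vdot_binormal in HB by easy.
    fold r1 in HN, HB.
    destruct Hk as [[Hk ->]|[Hk ->]].
    - fold r2 in HN, HB.
      set (a1 := r1 * cos (alpha1 s0)) in *. set (b1 := r1 * sin (alpha1 s0)) in *.
      set (a2 := r2 * cos (alpha2 s0)) in *. set (b2 := r2 * sin (alpha2 s0)) in *.
      assert (Ez : z = (b1 - k * b2) * a2 - (a1 - k * a2) * b2).
      { unfold z, a1, b1, a2, b2. ring. }
      assert (Bz : Rabs z <= eps * M).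
      { rewrite Ez. eapply Rle_trans; [apply Rabs_triang|]. rewrite Rabs_Ropp, !Rabs_mult.
        unfold M. fold a2 b2.
        pose proof (Rabs_pos a2); pose proof (Rabs_pos b2). nra. }
      assert (eps * M <= Rabs z / (2 * M) * M).
      { apply Rmult_le_compat_r; [lra|]. apply Rmin_r. }
      replace (Rabs z / (2 * M) * M) with (Rabs z / 2) in * by (field; lra). lra.
    (* A negative multiple of a dual ruling has negative normal component, whereas that of the first
       ruling is at least 2 eps. *)
    - rewrite cos_neg in HN. pose proof (sinbeta_pos c (fun t => - alpha2 t) s0) as R3.
      set (r3 := sinbeta c (fun t => - alpha2 t) s0) in *.
      assert (0 <= - (k * (r3 * cos (alpha2 s0)))).
      { assert (0 < r3 * cos (alpha2 s0)) by nra. nra. }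
      apply Rabs_le_between in HN.
      assert (eps <= r1 * cos (alpha1 s0) / 2) by apply Rmin_l. lra. }
  assert (sin (alpha1 s0 - alpha2 s0) = 0) as Hsin.
  { apply Rmult_integral in Z. destruct Z as [Z|Z]; [nra | exact Z]. }
  destruct (A1 s0 Hs0) as [I1 _]. destruct (A2 s0 Hs0) as [I2 _]. pose proof PI_RGT_0.
  destruct (Rtotal_order (alpha1 s0 - alpha2 s0) 0) as [C|[C|C]].
  - pose proof (sin_lt_0_var (alpha1 s0 - alpha2 s0)); lra.
  - lra.
  - pose proof (sin_gt_0 (alpha1 s0 - alpha2 s0)); lra.
Qed.

End GermInjectivity.

(** * Arc-length parametrizations *)

Lemma vderiv_comp c f s : vsmooth c -> smooth_fun f ->
  vderiv (fun t => c (f t)) s = vscal (Derive f s) (vderiv c (f s)).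
Proof.
  intros (C1 & C2 & C3) Hf.
  assert (A : forall g, smooth_fun g -> Derive (fun t => g (f t)) s = Derive f s * Derive g (f s)).
  { intros g Hg. apply is_derive_unique, is_derive_compR; now apply smooth_fun_is_derive. }
  apply V3_ext; simpl.
  - apply (A (fun t => x1 (c t)) C1).
  - apply (A (fun t => x2 (c t)) C2).
  - apply (A (fun t => x3 (c t)) C3).
Qed.

Lemma arclength_param_reflect c0 a b l phi : vsmooth c0 ->
  arclength_param c0 a b l phi -> arclength_param c0 a b l (fun s => phi (- s)).
Proof.
  intros Hc (Hs & He & Hr & Hu). split; [now apply smooth_fun_reflect|]. split; [|split].
  - rewrite Ropp_involutive. tauto.
  - intros s Hs'. apply Hr. unfold inJ in *; lra.
  - intros s Hs'. rewrite (vderiv_comp c0 (fun s => phi (- s)));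
      [|exact Hc | now apply smooth_fun_reflect].
    rewrite (Derive_reflect phi s Hs), <- (Hu (- s)) by (unfold inJ in *; lra).
    rewrite (vderiv_comp c0 phi) by easy. now rewrite !vnorm_vscal, Rabs_Ropp.
Qed.

Lemma continuous_speed c t : vsmooth c -> continuous (fun u => vnorm (vderiv c u)) t.
Proof.
  intros Hc. apply continuous_sqrt_comp. apply (Ck_at_vdot 0); apply vsmooth_vCk_at;
  exact (vsmooth_vderiv c Hc).
Qed.

Definition arclength (c : R -> V3) (a t : R) : R := RInt (fun u => vnorm (vderiv c u)) a t.

Lemma is_derive_arclength c a t : vsmooth c ->
  is_derive (arclength c a) t (vnorm (vderiv c t)).
Proof.
  intros Hc. apply (is_derive_RInt (fun u => vnorm (vderiv c u)) _ a t);
    [|now apply continuous_speed].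
  apply filter_forall; intros u. apply (@RInt_correct R_CompleteNormedModule).
  apply (@ex_RInt_continuous R_CompleteNormedModule). intros z _. now apply continuous_speed.
Qed.

Lemma arclength_injective c a b s t : vsmooth c ->
  (forall u, a <= u <= b -> vnorm (vderiv c u) <> 0) ->
  a <= s <= b -> a <= t <= b -> arclength c a s = arclength c a t -> s = t.
Proof.
  intros Hc Hr Hs Ht E.
  destruct (MVT_gen (arclength c a) s t (fun u => vnorm (vderiv c u))) as (x & Hx & Ex).
  - intros u _. now apply is_derive_arclength.
  - intros u _. apply continuity_pt_filterlim.
    apply (is_derive_continuous _ _ _ (is_derive_arclength c a u Hc)).
  - rewrite E, Rminus_diag in Ex. symmetry in Ex. apply Rmult_integral in Ex.
    destruct Ex as [Ex|Ex]; [|lra]. exfalso. apply (Hr x); [|exact Ex].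
    unfold Rmin, Rmax in Hx. destruct (Rle_dec s t); lra.
Qed.

Section Parametrization.
Variables (c0 : R -> V3) (a b l : R).
Hypothesis ab : a < b.
Hypothesis l_pos : 0 < l.
Hypothesis c0_smooth : vsmooth c0.
Hypothesis c0_regular : forall t, a <= t <= b -> vnorm (vderiv c0 t) <> 0.

(** Unit speed reads |phi'| |c0'(phi)| = 1, so phi' has no zero and keeps one sign; it is positive
    because phi runs from a to b > a. Thus the arc length of c0 composed with phi has derivative
    1. *)
Lemma arclength_increasing_param phi : arclength_param c0 a b l phi -> phi (- (l / 2)) = a ->
  forall s, inJ l s -> arclength c0 a (phi s) = s + l / 2.
Proof.
  intros (Hs & He & Hr & Hu) Ha.
  assert (Hb : phi (l / 2) = b) by (destruct He as [[_ ?]|[? _]]; lra).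
  assert (Sp : forall s, inJ l s -> Rabs (Derive phi s) * vnorm (vderiv c0 (phi s)) = 1).
  { intros s Hs'. rewrite <- vnorm_vscal, <- vderiv_comp by easy. now apply Hu. }
  assert (N : forall s, inJ l s -> Derive phi s <> 0).
  { intros s Hs' E. specialize (Sp s Hs'). rewrite E, Rabs_R0 in Sp. lra. }
  assert (C : forall s, continuous (Derive phi) s).
  { intros s. apply (smooth_fun_Ck_at _ 0). now apply smooth_fun_Derive. }
  assert (exists s, inJ l s /\ 0 < Derive phi s) as (s1 & Hs1 & P1).
  { destruct (MVT_gen phi (- (l / 2)) (l / 2) (Derive phi)) as (x & Hx & Ex).
    - intros x _. now apply smooth_fun_is_derive.
    - intros x _. apply continuity_pt_filterlim. now apply (smooth_fun_Ck_at _ 0).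
    - rewrite Rmin_left, Rmax_right in Hx by lra. exists x; split; [exact Hx|].
      rewrite Ha, Hb in Ex. nra. }
  assert (P : forall s, inJ l s -> 0 < Derive phi s).
  { intros s Hs'. apply (nonzero_same_sign (- (l / 2)) (l / 2) (Derive phi)) with s1; trivial. }
  intros s Hs'.
  pose proof (is_derive_0_constant (- (l / 2)) (l / 2) (fun s => arclength c0 a (phi s) - s)) as H.
  assert (E : arclength c0 a (phi s) - s = arclength c0 a (phi (- (l / 2))) - - (l / 2)).
  { apply H; [|exact Hs'|lra]. intros t Ht.
    apply is_derive_eq with (Derive phi t * vnorm (vderiv c0 (phi t)) - 1).
    - apply is_derive_minusR; [|apply (is_derive_id t)].
      apply (is_derive_compR (arclength c0 a) phi);
        [now apply is_derive_arclength | now apply smooth_fun_is_derive].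
    - specialize (Sp t Ht). rewrite Rabs_right in Sp by (specialize (P t Ht); lra). lra. }
  rewrite Ha in E. unfold arclength in E at 2. rewrite RInt_point in E.
  unfold zero in E; simpl in E. lra.
Qed.

Lemma arclength_param_orient phi : arclength_param c0 a b l phi ->
  phi (- (l / 2)) = a \/ phi (- - (l / 2)) = a.
Proof. intros (_ & He & _). rewrite Ropp_involutive. tauto. Qed.

Lemma arclength_param_injective phi : arclength_param c0 a b l phi ->
  forall s t, inJ l s -> inJ l t -> phi s = phi t -> s = t.
Proof.
  intros Hp s t Hs Ht E. destruct (arclength_param_orient phi Hp) as [H|H].
  - pose proof (arclength_increasing_param phi Hp H s Hs) as E1.
    pose proof (arclength_increasing_param phi Hp H t Ht) as E2. rewrite E in E1. lra.
  - apply arclength_param_reflect in Hp; [|exact c0_smooth].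
    pose proof (arclength_increasing_param _ Hp H (- s)) as E1.
    pose proof (arclength_increasing_param _ Hp H (- t)) as E2. unfold inJ in *.
    rewrite !Ropp_involutive in E1, E2. rewrite E in E1. lra.
Qed.

Lemma increasing_param_unique phi psi :
  arclength_param c0 a b l phi -> arclength_param c0 a b l psi ->
  phi (- (l / 2)) = a -> psi (- (l / 2)) = a -> forall s, inJ l s -> phi s = psi s.
Proof.
  intros H1 H2 E1 E2 s Hs. apply (arclength_injective c0 a b); trivial.
  - now apply H1.
  - now apply H2.
  - rewrite !arclength_increasing_param by easy. reflexivity.
Qed.

Lemma arclength_param_unique phi psi :
  arclength_param c0 a b l phi -> arclength_param c0 a b l psi ->
  (forall s, inJ l s -> psi s = phi s) \/ (forall s, inJ l s -> psi s = phi (- s)).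
Proof.
  intros H1 H2.
  pose proof (arclength_param_reflect c0 a b l phi c0_smooth H1) as H1'.
  pose proof (arclength_param_reflect c0 a b l psi c0_smooth H2) as H2'.
  destruct (arclength_param_orient phi H1) as [E1|E1];
    destruct (arclength_param_orient psi H2) as [E2|E2].
  - left. now apply increasing_param_unique.
  - right. intros s Hs.
    rewrite (increasing_param_unique phi _ H1 H2' E1 E2 (- s)) by (unfold inJ in *; lra).
    now rewrite Ropp_involutive.
  - right. now apply (increasing_param_unique psi (fun s => phi (- s))).
  - left. intros s Hs.
    pose proof (increasing_param_unique _ _ H2' H1' E2 E1 (- s)) as E.
    cbv beta in E. rewrite !Ropp_involutive in E. apply E. unfold inJ in *; lra.
Qed.

End Parametrization.

(** * Existence of the first angular function *)

(** At unit speed this is the signed curvature; [curv2] carries its absolute value. *)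
Definition det2 (g : R -> V2) (t : R) : R :=
  y1 (wderiv g t) * y2 (wderiv (wderiv g) t) - y2 (wderiv g t) * y1 (wderiv (wderiv g) t).

Lemma Ck_at_wderiv n g x : wsmooth g ->
  Ck_at n (fun t => y1 (wderiv g t)) x /\ Ck_at n (fun t => y2 (wderiv g t)) x /\
  Ck_at n (fun t => y1 (wderiv (wderiv g) t)) x /\ Ck_at n (fun t => y2 (wderiv (wderiv g) t)) x.
Proof.
  intros [H1 H2].
  pose proof (smooth_fun_Derive _ H1) as H1'. pose proof (smooth_fun_Derive _ H2) as H2'.
  pose proof (smooth_fun_Derive _ H1') as H1''. pose proof (smooth_fun_Derive _ H2') as H2''.
  split; [|split; [|split]].
  - exact (smooth_fun_Ck_at _ n x H1').
  - exact (smooth_fun_Ck_at _ n x H2').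
  - exact (smooth_fun_Ck_at _ n x H1'').
  - exact (smooth_fun_Ck_at _ n x H2'').
Qed.

Lemma Ck_at_det2 n g x : wsmooth g -> Ck_at n (det2 g) x.
Proof.
  intros Hg. destruct (Ck_at_wderiv n g x Hg) as (H1 & H2 & H3 & H4).
  apply Ck_at_minus; now apply Ck_at_mult.
Qed.

Lemma Ck_at_curv2 n g x : wsmooth g -> wnorm (wderiv g x) <> 0 -> det2 g x <> 0 ->
  Ck_at n (curv2 g) x.
Proof.
  intros Hg Hw Hd. destruct (Ck_at_wderiv n g x Hg) as (H1 & H2 & _).
  apply Ck_at_div.
  - apply (Ck_at_abs n (det2 g)); [now apply Ck_at_det2 | exact Hd].
  - apply Ck_at_pow. unfold wnorm. apply Ck_at_sqrt.
    + apply Ck_at_plus; now apply Ck_at_mult.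
    + apply Rnot_le_lt; intros N. apply Hw. unfold wnorm. now apply sqrt_neg_0.
  - now apply pow_nonzero.
Qed.

Lemma curv2_unit_speed g s : wnorm (wderiv g s) = 1 -> curv2 g s = Rabs (det2 g s).
Proof. intros H. unfold curv2, det2. rewrite H. field. Qed.

(** Points of the interval satisfy [P] themselves, so only the neighbourhoods of the two end points
    matter. The radius has the form expected by [smooth_extension]. *)
Lemma locally_near_interval h (P : R -> Prop) : 0 <= h ->
  (forall s, - h <= s <= h -> locally s P) ->
  exists d, 0 < d /\ forall s, Rabs s < h + 2 * d -> P s.
Proof.
  intros Hh H. destruct (H h ltac:(lra)) as [[d1 P1] H1]. destruct (H (- h) ltac:(lra)) as [[d2 P2] H2].
  exists (Rmin d1 d2 / 2). pose proof (Rmin_pos d1 d2 P1 P2).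
  pose proof (Rmin_l d1 d2); pose proof (Rmin_r d1 d2). split; [lra|].
  intros s Hs. apply Rabs_def2 in Hs.
  destruct (Rlt_dec h s); [|destruct (Rlt_dec s (- h))].
  - apply H1. change (Rabs (s - h) < d1). apply Rabs_def1; lra.
  - apply H2. change (Rabs (s - - h) < d2). apply Rabs_def1; lra.
  - apply (locally_singleton s P), H. lra.
Qed.

Lemma acos_strict_bounds x : 0 < x < 1 -> 0 < acos x < PI / 2.
Proof.
  intros Hx. pose proof (acos_bound x) as B. pose proof (cos_acos x ltac:(lra)) as E.
  pose proof PI_RGT_0. split.
  - destruct (Req_dec (acos x) 0) as [Z|Z]; [|lra]. rewrite Z, cos_0 in E. lra.
  - apply Rnot_le_lt; intros N. pose proof (cos_le_0 (acos x) N ltac:(lra)). lra.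
Qed.

Lemma angle_with_geodesic_curvature l c gamma sigma : 0 < l -> vsmooth c -> wsmooth gamma ->
  sigma = 1 \/ sigma = -1 ->
  (forall s, inJ l s -> vnorm (vderiv c s) = 1) ->
  (forall s, inJ l s -> wnorm (wderiv gamma s) = 1) ->
  (forall s, inJ l s -> 0 < curv2 gamma s) ->
  (forall s t, inJ l s -> inJ l t -> curv2 gamma s < curv c t) ->
  exists alpha, smooth_fun alpha /\ forall s, inJ l s ->
    0 < alpha s < PI / 2 /\ curv c s * cos (alpha s) = curv2 gamma (sigma * s).
Proof.
  intros Hl Hc Hg Hsig Uc Ug Kg Kc.
  assert (J : forall s, inJ l s -> inJ l (sigma * s)).
  { intros s Hs. unfold inJ in *. destruct Hsig as [-> | ->]; lra. }
  set (r := fun s => curv2 gamma (sigma * s) / curv c s).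
  (* Nonvanishing conditions under which [r] is smooth at [s]; they persist near J by continuity. *)
  set (regular := fun s => vnorm (vderiv c s) <> 0 /\ vnorm (bivector c s) <> 0 /\
                     wnorm (wderiv gamma (sigma * s)) <> 0 /\ det2 gamma (sigma * s) <> 0).
  assert (Cr : forall n s, regular s -> Ck_at n r s).
  { intros n s (R1 & R2 & R3 & R4). apply Ck_at_div.
    - apply (Ck_at_comp n (curv2 gamma) (fun s => sigma * s)); [now apply Ck_at_curv2|].
      apply Ck_at_mult; [apply Ck_at_const | apply Ck_at_id].
    - now apply Ck_at_curv.
    - unfold curv. apply Rmult_integral_contrapositive_currified; [exact R2|].
      now apply Rinv_neq_0_compat, pow_nonzero. }
  assert (Kpos : forall s, inJ l s -> 0 < curv c s).
  { intros s Hs. specialize (Kg s Hs). specialize (Kc s s Hs Hs). lra. }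
  assert (Rb : forall s, inJ l s -> 0 < r s < 1).
  { intros s Hs. pose proof (Kg _ (J s Hs)). pose proof (Kc _ s (J s Hs) Hs). unfold r. split.
    - apply Rdiv_lt_0_compat; lra.
    - apply (Rmult_lt_reg_r (curv c s)); [lra|]. unfold Rdiv.
      rewrite Rmult_assoc, Rinv_l by lra. lra. }
  assert (RJ : forall s, inJ l s -> regular s).
  { intros s Hs. pose proof (Kg _ (J s Hs)) as K1. rewrite curv2_unit_speed in K1 by now apply Ug, J.
    repeat split.
    - rewrite Uc by easy. lra.
    - rewrite bivector_norm_curv by now apply Uc. specialize (Kpos s Hs). lra.
    - rewrite Ug by now apply J. lra.
    - intros E. rewrite E, Rabs_R0 in K1. lra. }
  assert (RL : forall s, inJ l s -> locally s regular).
  { intros s Hs. destruct (RJ s Hs) as (R1 & R2 & R3 & R4).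
    assert (Cs : continuous (fun s => sigma * s) s).
    { apply (Ck_at_mult 0); [apply Ck_at_const | apply Ck_at_id]. }
    destruct (Ck_at_wderiv 0 gamma (sigma * s) Hg) as (W1 & W2 & _).
    repeat apply filter_and.
    - apply (locally_neq0 (fun t => vnorm (vderiv c t))); [now apply continuous_speed | exact R1].
    - apply (locally_neq0 (fun t => vnorm (bivector c t))); [|exact R2].
      apply (Ck_at_vnorm 0); [now apply vCk_at_bivector | exact R2].
    - apply (locally_neq0 (fun t => wnorm (wderiv gamma (sigma * t)))); [|exact R3].
      apply (continuous_comp (fun s => sigma * s) (fun t => wnorm (wderiv gamma t))); [exact Cs|].
      apply continuous_sqrt_comp. apply (Ck_at_plus 0); now apply (Ck_at_mult 0).
    - apply (locally_neq0 (fun t => det2 gamma (sigma * t))); [|exact R4].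
      apply (continuous_comp (fun s => sigma * s) (det2 gamma)); [exact Cs|].
      now apply (Ck_at_det2 0). }
  (* Outside J only the smoothness of [acos (r s)] is at stake, hence the bound -1 < r < 1;
     positivity of [r] serves on J, where it keeps the angle below pi / 2. *)
  destruct (locally_near_interval (l / 2) (fun s => regular s /\ -1 < r s < 1)) as (d & Hd & HP).
  - lra.
  - intros s Hs. pose proof (Cr O s (RJ s Hs)) as C0. pose proof (Rb s Hs).
    apply filter_and; [now apply RL|]. apply filter_and.
    + apply (locally_lt (fun _ => -1) r); [apply continuous_const | exact C0 | lra].
    + apply (locally_lt r (fun _ => 1)); [exact C0 | apply continuous_const | lra].
  - destruct (smooth_extension (l / 2) d (fun s => acos (r s)) Hd) as (alpha & Ha & Ea).
    + intros n s Hs. destruct (HP s Hs) as [R1 R2]. apply Ck_at_acos; [now apply Cr | exact R2].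
    + exists alpha; split; [exact Ha|]. intros s Hs. rewrite (Ea s Hs).
      pose proof (Rb s Hs) as B. split; [now apply acos_strict_bounds|].
      rewrite cos_acos by lra. unfold r. field. specialize (Kpos s Hs). lra.
Qed.

(** * Isometric reparametrizations of an arc *)

Definition vdist2 (u v : V3) : R := vdot (vsub u v) (vsub u v).

(** Each coordinate of the chord equals its first-order term up to d |y - s|, and squaring costs at
    most 3 d (y - s)^2 when d <= 1; three coordinates explain [eps / 9]. *)
Lemma vdist2_unit_speed c s eps : vsmooth c -> vnorm (vderiv c s) = 1 -> 0 < eps ->
  locally s (fun y => Rabs (vdist2 (c y) (c s) - (y - s) * (y - s)) <= eps * ((y - s) * (y - s))).
Proof.
  intros (C1 & C2 & C3) U He.
  assert (U2 : vdot (vderiv c s) (vderiv c s) = 1) by (rewrite <- vnorm_sqr, U; ring).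
  set (d := Rmin 1 (eps / 9)). assert (Hd : 0 < d) by (apply Rmin_pos; lra).
  assert (Hd1 : d <= 1) by apply Rmin_l. assert (Hd2 : d <= eps / 9) by apply Rmin_r.
  pose proof (is_derive_linear_approx _ _ _ d (smooth_fun_is_derive _ s C1) Hd) as L1.
  pose proof (is_derive_linear_approx _ _ _ d (smooth_fun_is_derive _ s C2) Hd) as L2.
  pose proof (is_derive_linear_approx _ _ _ d (smooth_fun_is_derive _ s C3) Hd) as L3.
  assert (Q : forall t D a, Rabs (D - a * t) <= d * Rabs t -> a * a <= 1 ->
            - (3 * d * (t * t)) <= D * D - a * a * (t * t) <= 3 * d * (t * t)).
  { intros t D a H Ha. set (r := D - a * t) in *. replace D with (a * t + r) by (unfold r; ring).
    assert (Hr : Rabs r * Rabs r <= d * d * (t * t)).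
    { replace (t * t) with (Rabs t * Rabs t) by (rewrite <- Rabs_mult; apply Rabs_right; nra).
      pose proof (Rabs_pos r). pose proof (Rabs_pos t). nra. }
    rewrite <- Rabs_mult, Rabs_right in Hr by nra.
    assert (Har : Rabs (a * t * r) <= d * (t * t)).
    { rewrite !Rabs_mult.
      assert (Rabs a <= 1) by (apply Rabs_le; nra).
      replace (t * t) with (Rabs t * Rabs t) by (rewrite <- Rabs_mult; apply Rabs_right; nra).
      pose proof (Rabs_pos a). pose proof (Rabs_pos r). pose proof (Rabs_pos t).
      assert (Rabs a * Rabs t <= Rabs t) by nra.
      assert (Rabs a * Rabs t * Rabs r <= Rabs t * (d * Rabs t)) by (apply Rmult_le_compat; nra).
      lra. }
    apply Rabs_le_between in Har. assert (0 <= t * t) by nra. assert (0 <= r * r) by nra.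
    assert (d * d * (t * t) <= d * (t * t)) by nra. nra. }
  generalize (filter_and _ _ L1 (filter_and _ _ L2 L3)).
  apply filter_imp. enough (A : forall y : R,
    Rabs (x1 (c y) - x1 (c s) - Derive (fun t => x1 (c t)) s * (y - s)) <= d * Rabs (y - s) /\
    Rabs (x2 (c y) - x2 (c s) - Derive (fun t => x2 (c t)) s * (y - s)) <= d * Rabs (y - s) /\
    Rabs (x3 (c y) - x3 (c s) - Derive (fun t => x3 (c t)) s * (y - s)) <= d * Rabs (y - s) ->
    Rabs (vdist2 (c y) (c s) - (y - s) * (y - s)) <= eps * ((y - s) * (y - s))) by exact A.
  intros y (M1 & M2 & M3). unfold vdot, vderiv in U2; simpl in U2.
  apply Q in M1; [|nra]. apply Q in M2; [|nra]. apply Q in M3; [|nra].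
  set (a1 := Derive (fun t => x1 (c t)) s) in *. set (a2 := Derive (fun t => x2 (c t)) s) in *.
  set (a3 := Derive (fun t => x3 (c t)) s) in *.
  set (t2 := (y - s) * (y - s)) in *.
  replace (vdist2 (c y) (c s)) with
    ((x1 (c y) - x1 (c s)) * (x1 (c y) - x1 (c s)) + (x2 (c y) - x2 (c s)) * (x2 (c y) - x2 (c s))
     + (x3 (c y) - x3 (c s)) * (x3 (c y) - x3 (c s)))
    by (unfold vdist2, vdot, vsub, vadd, vscal; simpl; ring).
  assert (0 <= t2) by apply Rle_0_sqr.
  assert (9 * d * t2 <= eps * t2) by (apply Rmult_le_compat_r; lra).
  assert (t2 = a1 * a1 * t2 + a2 * a2 * t2 + a3 * a3 * t2)
    by (replace t2 with (1 * t2) at 1 by ring; rewrite <- U2; ring).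
  apply Rabs_le. lra.
Qed.

(* The segment from (u, v) to (s, t) avoids the diagonal, so g t - g s keeps its sign along it. *)
Lemma injective_continuous_monotone u v (g : R -> R) : u < v -> (forall s, continuous g s) ->
  (forall s t, u <= s <= v -> u <= t <= v -> g s = g t -> s = t) ->
  exists sigma, (sigma = 1 \/ sigma = -1) /\
    forall s t, u <= s <= v -> u <= t <= v -> s < t -> 0 < sigma * (g t - g s).
Proof.
  intros Huv Cg Ig.
  assert (N : g v - g u <> 0).
  { intros E. assert (v = u) by (apply Ig; lra). lra. }
  assert (Main : forall sigma, sigma = 1 \/ sigma = -1 -> 0 < sigma * (g v - g u) ->
    forall s t, u <= s <= v -> u <= t <= v -> s < t -> 0 < sigma * (g t - g s)).
  { intros sigma Hsig P s t Hs Ht Hst.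
    set (F := fun x => sigma * (g ((1 - x) * v + x * t) - g ((1 - x) * u + x * s))).
    assert (CL : forall p q x, continuous (fun x => g ((1 - x) * p + x * q)) x).
    { intros p q x. apply (continuous_comp (fun x => (1 - x) * p + x * q) g); [|apply Cg].
      apply (Ck_at_plus 0).
      - apply (Ck_at_mult 0); [|apply Ck_at_const].
        apply Ck_at_minus; [apply Ck_at_const | apply Ck_at_id].
      - apply (Ck_at_mult 0); [apply Ck_at_id | apply Ck_at_const]. }
    assert (0 < F 1).
    { apply (nonzero_same_sign 0 1 F) with 0; try lra.
      - intros x _. apply (Ck_at_mult 0); [apply Ck_at_const|].
        apply (Ck_at_minus 0); apply CL.
      - intros x Hx. unfold F. apply Rmult_integral_contrapositive_currified.
        { destruct Hsig; lra. }
        intros E. assert ((1 - x) * v + x * t = (1 - x) * u + x * s).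
        { apply Ig; [nra | nra | lra]. }
        assert (0 <= (1 - x) * (v - u)) by nra. assert (0 <= x * (t - s)) by nra.
        destruct (Rle_dec x (/ 2)); nra.
      - unfold F. replace ((1 - 0) * v + 0 * t) with v by ring.
        replace ((1 - 0) * u + 0 * s) with u by ring. exact P. }
    unfold F in H. replace ((1 - 1) * v + 1 * t) with t in H by ring.
    replace ((1 - 1) * u + 1 * s) with s in H by ring. exact H. }
  destruct (Rtotal_order (g v - g u) 0) as [H|[H|H]]; [|easy|].
  - exists (-1). split; [now right|]. apply Main; [now right | lra].
  - exists 1. split; [now left|]. apply Main; [now left | lra].
Qed.

(** An injective arc is homeomorphic to its interval, so [h] is continuous; being injective it is
    monotone, and since chords and parameters agree to first order its slope is 1 or -1. An affine
    self-map of J with such a slope is the identity or the reversal. *)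
Lemma isometric_reparametrization l c h : 0 < l -> vsmooth c ->
  (forall s, inJ l s -> vnorm (vderiv c s) = 1) ->
  (forall s t, inJ l s -> inJ l t -> c s = c t -> s = t) ->
  (forall s, inJ l s -> inJ l (h s)) ->
  (forall s t, inJ l s -> inJ l t -> vdist2 (c (h s)) (c (h t)) = vdist2 (c s) (c t)) ->
  (forall s, inJ l s -> h s = s) \/ (forall s, inJ l s -> h s = - s).
Proof.
  intros Hl Hc Hu Hi HJ Hd.
  set (u := - (l / 2)). set (v := l / 2). assert (Huv : u < v) by (unfold u, v; lra).
  assert (JE : forall s, inJ l s <-> u <= s <= v) by (intros; unfold inJ, u, v; tauto).
  (* [h] is constrained only on J; precomposing with the retraction onto J gives a function
     continuous on the whole line. *)
  set (g := fun s => h (clamp u v s)).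
  assert (Jc : forall s, inJ l (clamp u v s)) by (intros s; apply JE, clamp_in; lra).
  assert (gh : forall s, inJ l s -> g s = h s).
  { intros s Hs. unfold g. rewrite clamp_id; [easy | now apply JE]. }
  assert (C0 : forall s, vCk_at 0 c s) by (intros s; now apply vsmooth_vCk_at).
  assert (Cg : forall s, continuous g s).
  { intros s. apply filterlim_locally. intros [eps He]. simpl.
    destruct (injective_curve_inverse_continuous u v c (g s) eps) as (eta & Heta & Hinv).
    - intros; apply C0.
    - intros p q Hp Hq. apply Hi; now apply JE.
    - apply JE, HJ, Jc.
    - exact He.
    - assert (CD : continuous (fun y => vdist2 (c (clamp u v y)) (c (clamp u v s))) s).
      { apply (continuous_comp (clamp u v) (fun y => vdist2 (c y) (c (clamp u v s)))).
        - apply continuous_clamp; lra.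
        - assert (vCk_at 0 (fun y => vsub (c y) (c (clamp u v s))) (clamp u v s)).
          { apply vCk_at_vadd; [apply C0 | apply vCk_at_const]. }
          now apply (Ck_at_vdot 0). }
      generalize (locally_lt _ (fun _ => eta) s CD (continuous_const _ _)).
      unfold vdist2 at 1, vdot at 1, vsub, vadd, vscal; simpl. intros HL.
      assert (HL' := HL ltac:(ring_simplify; exact Heta)). revert HL'.
      apply filter_imp; intros y Hy. change (Rabs (g y - g s) < eps). apply Hinv.
      + apply JE, HJ, Jc.
      + change (vdist2 (c (g y)) (c (g s)) < eta). unfold g. rewrite Hd by apply Jc. exact Hy. }
  assert (Ig : forall s t, u <= s <= v -> u <= t <= v -> g s = g t -> s = t).
  { intros s t Hs Ht E. apply Hi; try now apply JE.
    rewrite !gh in E by now apply JE.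
    pose proof (Hd s t ltac:(now apply JE) ltac:(now apply JE)) as D. rewrite E in D.
    assert (Z : vdist2 (c s) (c t) = 0).
    { rewrite <- D. unfold vdist2, vdot, vsub, vadd, vscal; simpl; ring. }
    apply vdot_self_eq0 in Z. unfold vsub, vadd, vscal in Z. injection Z as Z1 Z2 Z3.
    apply V3_ext; lra. }
  destruct (injective_continuous_monotone u v g Huv Cg Ig) as (sigma & Hsig & Mono).
  assert (Sig2 : sigma * sigma = 1) by (destruct Hsig; subst; ring).
  assert (Dg : forall s, u < s < v -> is_derive g s sigma).
  { intros s Hs. apply is_derive_Reals. intros eps He.
    (* The bound 1/2 gives r^2 <= 4 below, then |r^2 - 1| <= d (1 + r^2) <= 5 d, and [eps / 8] makes
       5 d < eps. *)
    set (d := Rmin (/ 2) (eps / 8)). assert (P : 0 < d) by (apply Rmin_pos; lra).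
    assert (P1 : d <= / 2) by apply Rmin_l. assert (P2 : d <= eps / 8) by apply Rmin_r.
    assert (Js : inJ l s) by (apply JE; lra).
    pose proof (vdist2_unit_speed c s d Hc (Hu s Js) P) as L1.
    pose proof (vdist2_unit_speed c (g s) d Hc (Hu _ (HJ _ (Jc s))) P) as L2.
    apply Cg in L2. unfold filtermap in L2.
    pose proof (open_gt u s (proj1 Hs)) as L3. pose proof (open_lt v s (proj2 Hs)) as L4.
    destruct (filter_and _ _ (filter_and _ _ L1 L2) (filter_and _ _ L3 L4)) as [rho HL].
    exists rho. intros x Hx0 Hx.
    destruct (HL (s + x)) as ((M1 & M2) & M3 & M4).
    { change (Rabs (s + x - s) < rho). now replace (s + x - s) with x by ring. }
    assert (Jx : inJ l (s + x)) by (apply JE; lra).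
    rewrite (gh (s + x) Jx), (gh s Js) in *. rewrite Hd in M2 by easy.
    replace (s + x - s) with x in M1 by ring.
    assert (Sgn : 0 < sigma * (h (s + x) - h s) * x).
    { rewrite <- (gh (s + x) Jx), <- (gh s Js).
      destruct (Rtotal_order x 0) as [Hn|[Hn|Hn]]; [|lra|].
      - pose proof (Mono (s + x) s ltac:(lra) ltac:(lra) ltac:(lra)). nra.
      - pose proof (Mono s (s + x) ltac:(lra) ltac:(lra) ltac:(lra)). nra. }
    set (D := h (s + x) - h s) in *. set (q := vdist2 (c (s + x)) (c s)) in *.
    apply Rabs_le_between in M1. apply Rabs_le_between in M2.
    (* Monotonicity makes [r] positive, so |r - 1| <= |r^2 - 1|, and squared distances control the
       slope together with its sign. *)
    set (r := sigma * D / x).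
    assert (ED : D = sigma * (r * x)).
    { unfold r. replace (sigma * (sigma * D / x * x)) with (sigma * sigma * D) by (field; lra).
      rewrite Sig2; ring. }
    assert (Hr : 0 < r).
    { unfold r. replace (sigma * D / x) with (sigma * D * x * (/ x * / x)) by (field; lra).
      apply Rmult_lt_0_compat; [lra|]. assert (/ x <> 0) by now apply Rinv_neq_0_compat. nra. }
    assert (x2 : 0 < x * x) by nra.
    assert (DD : D * D = r * r * (x * x)).
    { rewrite ED. transitivity (sigma * sigma * (r * r * (x * x))); [ring | rewrite Sig2; ring]. }
    rewrite DD in M2.
    assert (B1 : (1 - d) * (r * r) <= 1 + d).
    { apply (Rmult_le_reg_r (x * x)); [exact x2|]. nra. }
    assert (B2 : 1 - d <= (1 + d) * (r * r)).
    { apply (Rmult_le_reg_r (x * x)); [exact x2|]. nra. }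
    assert (B3 : r * r <= 4) by nra.
    assert (B5 : - (5 * d) <= (r - 1) * (r + 1) <= 5 * d) by (split; nra).
    assert (B4 : - (5 * d) <= r - 1 <= 5 * d).
    { clear - B5 Hr P. split; apply Rnot_lt_le; intros N; nra. }
    replace (D / x - sigma) with (sigma * (r - 1)) by (rewrite ED; field; lra).
    rewrite Rabs_mult. replace (Rabs sigma) with 1
      by (destruct Hsig; subst sigma; unfold Rabs; destruct Rcase_abs; lra).
    rewrite Rmult_1_l. apply Rabs_def1; lra. }
  assert (Aff : forall s, inJ l s -> h s = h u + sigma * (s - u)).
  { intros s Js. assert (Hs : u <= s <= v) by now apply JE.
    assert (Ju : inJ l u) by (apply JE; lra).
    rewrite <- (gh s), <- (gh u) by easy.
    destruct (MVT_gen g u s (fun _ => sigma)) as (x & _ & Ex).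
    - intros x Hx. apply Dg. rewrite Rmin_left, Rmax_right in Hx by lra. lra.
    - intros x _. apply continuity_pt_filterlim, Cg.
    - lra. }
  assert (Ju : inJ l u) by (apply JE; lra). assert (Jv : inJ l v) by (apply JE; lra).
  (* The images of the two end points lie in J at distance l from each other, which fixes the
     translation. *)
  pose proof (Aff v Jv) as Av. pose proof (HJ u Ju) as Bu. pose proof (HJ v Jv) as Bv.
  unfold inJ, u, v in *. destruct Hsig as [-> | ->]; [left|right]; intros s Hs;
    rewrite (Aff s Hs); lra.
Qed.

(** * Symmetries of a plane arc *)

Lemma is_derive_linear_comb f1 f2 A B E (s : R) : smooth_fun f1 -> smooth_fun f2 ->
  is_derive (fun t => A * f1 t + B * f2 t + E) s (A * Derive f1 s + B * Derive f2 s).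
Proof.
  intros H1 H2. auto_derive.
  - repeat split; [apply (H1 O) | apply (H2 O)].
  - change (fun x : R => f1 x) with f1. change (fun x : R => f2 x) with f2. ring.
Qed.

Lemma is_derive_linear_comb_reflect f1 f2 A B E (s : R) : smooth_fun f1 -> smooth_fun f2 ->
  is_derive (fun t => A * f1 (- t) + B * f2 (- t) + E) s
    (- A * Derive f1 (- s) + - B * Derive f2 (- s)).
Proof.
  intros H1 H2.
  apply is_derive_eq with (- (A * Derive f1 (- s) + B * Derive f2 (- s))); [|ring].
  apply (is_derive_reflect (fun t => A * f1 t + B * f2 t + E)).
  now apply is_derive_linear_comb.
Qed.

(** Differentiating twice undoes the sign coming from s -> -s and removes the constants, so the
    coefficients return unchanged. *)
Lemma second_derivative_reflect l f1 f2 A B E A' B' E' : 0 < l ->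
  smooth_fun f1 -> smooth_fun f2 ->
  (forall s, inJ l s -> A * f1 s + B * f2 s + E = A' * f1 (- s) + B' * f2 (- s) + E') ->
  forall s, inJ l s -> A * Derive (Derive f1) s + B * Derive (Derive f2) s
    = A' * Derive (Derive f1) (- s) + B' * Derive (Derive f2) (- s).
Proof.
  intros Hl S1 S2 H.
  pose proof (smooth_fun_Derive _ S1) as S1'. pose proof (smooth_fun_Derive _ S2) as S2'.
  assert (Hu : - (l / 2) < l / 2) by lra.
  assert (H1 : forall s, inJ l s -> A * Derive f1 s + B * Derive f2 s + 0 =
                 - A' * Derive f1 (- s) + - B' * Derive f2 (- s) + 0).
  { intros s Hs. rewrite !Rplus_0_r.
    exact (is_derive_unique_on _ _ _ _ s _ _ Hu Hs H
             (is_derive_linear_comb f1 f2 A B E s S1 S2)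
             (is_derive_linear_comb_reflect f1 f2 A' B' E' s S1 S2)). }
  intros s Hs.
  rewrite (is_derive_unique_on _ _ _ _ s _ _ Hu Hs H1
             (is_derive_linear_comb _ _ A B 0 s S1' S2')
             (is_derive_linear_comb_reflect _ _ (- A') (- B') 0 s S1' S2')).
  ring.
Qed.

Lemma wnorm_1 p : wnorm p = 1 -> y1 p * y1 p + y2 p * y2 p = 1.
Proof.
  intros H. unfold wnorm in H. rewrite <- (sqrt_sqrt (y1 p * y1 p + y2 p * y2 p)) by nra.
  rewrite H; ring.
Qed.

Lemma wdist_eq p q p' q' : wdist p q = wdist p' q' ->
  (y1 p - y1 q) * (y1 p - y1 q) + (y2 p - y2 q) * (y2 p - y2 q) =
  (y1 p' - y1 q') * (y1 p' - y1 q') + (y2 p' - y2 q') * (y2 p' - y2 q').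
Proof.
  unfold wdist, wnorm; simpl. intros H.
  apply sqrt_inj; [| |exact H]; apply Rplus_le_le_0_compat; apply Rle_0_sqr.
Qed.

Lemma V2_ext p q : y1 p = y1 q -> y2 p = y2 q -> p = q.
Proof. destruct p, q; simpl; intros; subst; reflexivity. Qed.

Section PlaneArc.
Variables (l : R) (gamma : R -> V2).
Hypothesis l_pos : 0 < l.
Hypothesis gamma_smooth : wsmooth gamma.
Hypothesis gamma_unit : forall s, inJ l s -> wnorm (wderiv gamma s) = 1.
Hypothesis gamma_curv : forall s, inJ l s -> 0 < curv2 gamma s.

Let g1 t := y1 (gamma t).
Let g2 t := y2 (gamma t).
Let p := Derive g1.
Let q := Derive g2.
Let Gamma := fun x => exists s, inJ l s /\ gamma s = x.

Let g1_smooth : smooth_fun g1 := proj1 gamma_smooth.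
Let g2_smooth : smooth_fun g2 := proj2 gamma_smooth.
Let p_smooth : smooth_fun p := smooth_fun_Derive g1 g1_smooth.
Let q_smooth : smooth_fun q := smooth_fun_Derive g2 g2_smooth.

Lemma unit_velocity s : inJ l s -> p s * p s + q s * q s = 1.
Proof. intros Hs. exact (wnorm_1 _ (gamma_unit s Hs)). Qed.

Lemma unit_velocity_orthogonal s : inJ l s -> p s * Derive p s + q s * Derive q s = 0.
Proof.
  intros Hs.
  assert (D : is_derive (fun t => p t * p t + q t * q t) s
    (Derive p s * p s + p s * Derive p s + (Derive q s * q s + q s * Derive q s))).
  { apply is_derive_plusR; apply is_derive_multR; now apply smooth_fun_is_derive. }
  pose proof (is_derive_unique_on (- (l / 2)) (l / 2) _ (fun _ => 1) s _ 0 ltac:(lra) Hs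
    unit_velocity D (is_derive_const 1 s)). lra.
Qed.

(** The planar Frenet equations. *)
Lemma det2_acceleration s : inJ l s ->
  Derive p s = - det2 gamma s * q s /\ Derive q s = det2 gamma s * p s.
Proof.
  intros Hs. pose proof (unit_velocity s Hs) as U. pose proof (unit_velocity_orthogonal s Hs) as O.
  change (det2 gamma s) with (p s * Derive q s - q s * Derive p s).
  set (P := p s) in *. set (Q := q s) in *. set (P' := Derive p s) in *. set (Q' := Derive q s) in *.
  split.
  - transitivity (P' * (P * P + Q * Q) - P * (P * P' + Q * Q')); [rewrite U, O; ring | ring].
  - transitivity (Q' * (P * P + Q * Q) - Q * (P * P' + Q * Q')); [rewrite U, O; ring | ring].
Qed.

Lemma curv2_sqr s : inJ l s ->
  curv2 gamma s * curv2 gamma s = Derive p s * Derive p s + Derive q s * Derive q s.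
Proof.
  intros Hs. rewrite curv2_unit_speed by now apply gamma_unit.
  rewrite <- Rabs_mult, Rabs_right by nra.
  destruct (det2_acceleration s Hs) as [-> ->]. pose proof (unit_velocity s Hs) as U.
  set (k := det2 gamma s). transitivity (k * k * (p s * p s + q s * q s)); [rewrite U; ring | ring].
Qed.

Lemma det2_neq0 s : inJ l s -> det2 gamma s <> 0.
Proof.
  intros Hs E. pose proof (gamma_curv s Hs) as K.
  rewrite curv2_unit_speed, E, Rabs_R0 in K by now apply gamma_unit. lra.
Qed.

(** If T moved [x], every fixed point would lie on the perpendicular bisector of [x] and [T x],
    whose equation has the coefficients [A], [B], [E]. Differentiating it along gamma makes (A, B)
    orthogonal to gamma'(0) and gamma''(0), which are independent since the curvature is nonzero. *)
Lemma arc_fixed_isometry_id T : (forall x y, wdist (T x) (T y) = wdist x y) ->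
  (forall s, inJ l s -> T (gamma s) = gamma s) -> forall x, T x = x.
Proof.
  intros HT Hf x. set (A := y1 x - y1 (T x)). set (B := y2 x - y2 (T x)).
  set (E := (y1 (T x) * y1 (T x) + y2 (T x) * y2 (T x) - y1 x * y1 x - y2 x * y2 x) / 2).
  assert (Hu : - (l / 2) < l / 2) by lra.
  assert (H0 : forall s, inJ l s -> A * g1 s + B * g2 s + E = 0).
  { intros s Hs. pose proof (wdist_eq _ _ _ _ (HT x (gamma s))) as D. rewrite (Hf s Hs) in D.
    fold (g1 s) (g2 s) in D. unfold A, B, E. lra. }
  assert (H1 : forall s, inJ l s -> A * p s + B * q s + 0 = 0).
  { intros s Hs. rewrite Rplus_0_r.
    exact (is_derive_unique_on _ _ _ (fun _ => 0) s _ 0 Hu Hs H0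
      (is_derive_linear_comb g1 g2 A B E s g1_smooth g2_smooth) (is_derive_const 0 s)). }
  assert (J0 : inJ l 0) by (unfold inJ; lra).
  assert (H2 : A * Derive p 0 + B * Derive q 0 = 0).
  { exact (is_derive_unique_on _ _ _ (fun _ => 0) 0 _ 0 Hu J0 H1
      (is_derive_linear_comb p q A B 0 0 p_smooth q_smooth) (is_derive_const 0 0)). }
  specialize (H1 0 J0). pose proof (det2_neq0 0 J0) as N.
  change (p 0 * Derive q 0 - q 0 * Derive p 0 <> 0) in N.
  assert (ZA : A = 0).
  { apply Rmult_eq_reg_r with (p 0 * Derive q 0 - q 0 * Derive p 0); [|exact N].
    transitivity ((A * p 0 + B * q 0 + 0) * Derive q 0 - q 0 * (A * Derive p 0 + B * Derive q 0));
      [ring | rewrite H1, H2; ring]. }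
  assert (ZB : B = 0).
  { apply Rmult_eq_reg_r with (p 0 * Derive q 0 - q 0 * Derive p 0); [|exact N].
    transitivity (p 0 * (A * Derive p 0 + B * Derive q 0) - (A * p 0 + B * q 0 + 0) * Derive p 0);
      [ring | rewrite H1, H2; ring]. }
  unfold A, B in *. apply V2_ext; lra.
Qed.

(** Distances determine the inner products of chords issuing from gamma(0). Differentiating twice in
    s and twice in t, then setting t = s, compares |gamma''|^2 at s and -s; at unit speed this is
    the squared curvature. *)
Lemma curv2_even_of_reversal :
  (forall s t, inJ l s -> inJ l t ->
     wdist (gamma (- s)) (gamma (- t)) = wdist (gamma s) (gamma t)) ->
  forall s, inJ l s -> curv2 gamma (- s) = curv2 gamma s.
Proof.
  intros H. assert (J0 : inJ l 0) by (unfold inJ; lra).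
  assert (Jn : forall s, inJ l s -> inJ l (- s)) by (intros s; unfold inJ; lra).
  set (o1 := g1 0). set (o2 := g2 0).
  (* polarization about gamma 0 makes the identity affine in gamma s and in gamma t *)
  assert (Pol : forall s t, inJ l s -> inJ l t ->
    (g1 t - o1) * g1 s + (g2 t - o2) * g2 s + - ((g1 t - o1) * o1 + (g2 t - o2) * o2) =
    (g1 (- t) - o1) * g1 (- s) + (g2 (- t) - o2) * g2 (- s)
      + - ((g1 (- t) - o1) * o1 + (g2 (- t) - o2) * o2)).
  { intros s t Hs Ht.
    pose proof (wdist_eq _ _ _ _ (H s t Hs Ht)) as D1.
    pose proof (wdist_eq _ _ _ _ (H s 0 Hs J0)) as D2.
    pose proof (wdist_eq _ _ _ _ (H t 0 Ht J0)) as D3.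
    rewrite Ropp_0 in D2, D3.
    fold (g1 s) (g2 s) (g1 t) (g2 t) (g1 (- s)) (g2 (- s)) (g1 (- t)) (g2 (- t))
      (g1 0) (g2 0) in D1, D2, D3.
    fold o1 o2 in D2, D3. lra. }
  assert (E1 : forall s t, inJ l s -> inJ l t ->
    Derive p s * g1 t + Derive q s * g2 t + - (Derive p s * o1 + Derive q s * o2) =
    Derive p (- s) * g1 (- t) + Derive q (- s) * g2 (- t)
      + - (Derive p (- s) * o1 + Derive q (- s) * o2)).
  { intros s t Hs Ht.
    pose proof (second_derivative_reflect l g1 g2 _ _ _ _ _ _ l_pos g1_smooth g2_smooth
                  (fun s Hs => Pol s t Hs Ht) s Hs) as E. fold p q in E. lra. }
  intros s Hs.
  pose proof (second_derivative_reflect l g1 g2 _ _ _ _ _ _ l_pos g1_smooth g2_smooth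
                (fun t Ht => E1 s t Hs Ht) s Hs) as E2. fold p q in E2.
  rewrite <- !curv2_sqr in E2 by auto.
  pose proof (gamma_curv s Hs). pose proof (gamma_curv _ (Jn s Hs)).
  apply Rsqr_inj; [lra | lra | now unfold Rsqr].
Qed.

Hypothesis gamma_inj : forall s t, inJ l s -> inJ l t -> gamma s = gamma t -> s = t.

Lemma symmetry_curv2_even : has_symmetry2 Gamma ->
  forall s, inJ l s -> curv2 gamma (- s) = curv2 gamma s.
Proof.
  intros (T & HT & (x0 & Hx0) & HG).
  (* T maps the arc to itself, so it acts on the arc-length parameter; outside J the value is
     arbitrary. *)
  assert (CH : forall s, {t | inJ l s -> inJ l t /\ gamma t = T (gamma s)}).
  { intros s. apply constructive_indefinite_description.
    destruct (classic (inJ l s)) as [Hs|Hs]; [|exists 0; tauto].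
    destruct (proj2 (HG (T (gamma s)))) as (t & Ht & Et).
    - exists (gamma s). split; [now exists s | easy].
    - exists t. intros _. now split. }
  set (h := fun s => proj1_sig (CH s)).
  assert (Hh : forall s, inJ l s -> inJ l (h s) /\ gamma (h s) = T (gamma s)).
  { intros s. exact (proj2_sig (CH s)). }
  (* The arc is placed in a coordinate plane of space, where [isometric_reparametrization]
     applies. *)
  set (c := fun t => mkV3 (g1 t) (g2 t) 0).
  assert (E2 : forall s t, vdist2 (c s) (c t) =
    (g1 s - g1 t) * (g1 s - g1 t) + (g2 s - g2 t) * (g2 s - g2 t)).
  { intros s t. unfold vdist2, vdot, vsub, vadd, vscal, c; simpl; ring. }
  destruct (isometric_reparametrization l c h) as [E|E]; trivial.
  - split; [exact g1_smooth|]. split; [exact g2_smooth|].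
    apply smooth_fun_intro; intros n x. exact (Ck_at_const n 0 x).
  - intros s Hs. unfold vnorm, vdot, vderiv, c; simpl. rewrite Derive_const.
    change (Derive (fun u => g1 u) s) with (p s). change (Derive (fun u => g2 u) s) with (q s).
    rewrite (unit_velocity s Hs). rewrite Rmult_0_l, Rplus_0_r. apply sqrt_1.
  - intros s t Hs Ht E. apply gamma_inj; trivial. injection E as E1 E3. now apply V2_ext.
  - intros s Hs. now apply Hh.
  - intros s t Hs Ht. rewrite !E2. unfold g1, g2. apply wdist_eq.
    destruct (Hh s Hs) as [_ ->]. destruct (Hh t Ht) as [_ ->]. apply HT.
  - exfalso. apply Hx0. apply arc_fixed_isometry_id; trivial.
    intros s Hs. destruct (Hh s Hs) as [_ <-]. now rewrite E.
  - apply curv2_even_of_reversal. intros s t Hs Ht.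
    rewrite <- (E s Hs), <- (E t Ht). destruct (Hh s Hs) as [_ ->]. destruct (Hh t Ht) as [_ ->].
    apply HT.
Qed.

(* The symmetry is the reflection in the normal line at gamma 0: both gamma s and its mirror image
   traversed backwards have the same curvature and the same initial frame. *)
Lemma curv2_even_symmetry : (forall s, inJ l s -> curv2 gamma (- s) = curv2 gamma s) ->
  has_symmetry2 Gamma.
Proof.
  intros Hev. assert (J0 : inJ l 0) by (unfold inJ; lra).
  assert (Jn : forall s, inJ l s -> inJ l (- s)) by (intros s; unfold inJ; lra).
  set (k := det2 gamma).
  (* [curv2] only gives |k|; as the signed curvature never vanishes on J, it keeps its sign and is
     even as well. *)
  assert (kev : forall s, inJ l s -> k (- s) = k s).
  { intros s Hs. pose proof (Hev s Hs) as E. rewrite !curv2_unit_speed in E by auto.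
    fold k in E. pose proof (det2_neq0 s Hs) as N1. fold k in N1.
    assert (Ck : forall t, continuous k t) by (intros t; now apply (Ck_at_det2 0)).
    assert (SS : forall f, (forall t, continuous f t) -> (forall t, inJ l t -> f t <> 0) ->
              0 < f s -> 0 < f (- s)).
    { intros f Cf Nf.
      exact (nonzero_same_sign (- (l / 2)) (l / 2) f (fun t _ => Cf t) Nf s (- s) Hs (Jn s Hs)). }
    destruct (Rtotal_order (k s) 0) as [C|[C|C]]; [|easy|].
    - assert (0 < - k (- s)).
      { apply (SS (fun t => - k t)); [| |lra].
        - intros t. apply (continuous_opp k t), Ck.
        - intros t Ht Z. apply (det2_neq0 t Ht). fold k. lra. }
      rewrite !Rabs_left in E by lra. lra.
    - assert (0 < k (- s)) by (apply (SS k); auto; exact det2_neq0).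
      rewrite !Rabs_right in E by lra. lra. }
  set (a0 := p 0). set (b0 := q 0). set (o1 := g1 0). set (o2 := g2 0).
  pose proof (unit_velocity 0 J0) as U0. fold a0 b0 in U0.
  (* Components of the velocity along the tangent and the normal at gamma(0): cosine and sine of the
     turning angle. *)
  set (u := fun t => a0 * p t + b0 * q t + 0). set (w := fun t => - b0 * p t + a0 * q t + 0).
  assert (Du : forall s, inJ l s -> is_derive u s (- k s * w s)).
  { intros s Hs. destruct (det2_acceleration s Hs) as [A1 A2]. fold k in A1, A2.
    eapply is_derive_eq; [apply (is_derive_linear_comb p q a0 b0 0 s p_smooth q_smooth)|].
    rewrite A1, A2. unfold w; ring. }
  assert (Dw : forall s, inJ l s -> is_derive w s (k s * u s)).
  { intros s Hs. destruct (det2_acceleration s Hs) as [A1 A2]. fold k in A1, A2.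
    eapply is_derive_eq; [apply (is_derive_linear_comb p q (- b0) a0 0 s p_smooth q_smooth)|].
    rewrite A1, A2. unfold u; ring. }
  assert (Sym : forall s, inJ l s -> u (- s) = u s /\ w (- s) = - w s).
  { intros s Hs.
    (* (u(t), w(t)) and (u(-t), -w(-t)) solve the same rotation equation with rate k, so their
       squared distance is constant; it vanishes at 0. *)
    set (F := fun t => (u t - u (- t)) * (u t - u (- t)) + (w t + w (- t)) * (w t + w (- t))).
    assert (F s = F 0) as EF.
    { apply (is_derive_0_constant (- (l / 2)) (l / 2) F); trivial. intros t Ht.
      assert (D1 : is_derive (fun t => u t - u (- t)) t (- k t * w t - - (- k (- t) * w (- t)))).
      { apply is_derive_minusR; [now apply Du|]. apply is_derive_reflect. now apply Du, Jn. }
      assert (D2 : is_derive (fun t => w t + w (- t)) t (k t * u t + - (k (- t) * u (- t)))).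
      { apply is_derive_plusR; [now apply Dw|]. apply is_derive_reflect. now apply Dw, Jn. }
      rewrite (kev t Ht) in D1, D2.
      eapply is_derive_eq;
        [apply is_derive_plusR; apply is_derive_multR; [exact D1|exact D1|exact D2|exact D2]|].
      cbv beta. ring. }
    assert (F 0 = 0) as F0.
    { unfold F. rewrite Ropp_0. unfold w. fold a0 b0. ring. }
    rewrite F0 in EF. destruct (Rplus_sqr_eq_0 _ _ EF). split; lra. }
  (* Position in the same frame: by integration the tangential coordinate is odd about its value at
     0 and the normal one is even. *)
  set (a := fun t => a0 * g1 t + b0 * g2 t + 0). set (b := fun t => - b0 * g1 t + a0 * g2 t + 0).
  assert (Da : forall s, is_derive a s (u s)).
  { intros s. eapply is_derive_eq;
      [apply (is_derive_linear_comb g1 g2 a0 b0 0 s g1_smooth g2_smooth)|].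
    unfold u, p, q; ring. }
  assert (Db : forall s, is_derive b s (w s)).
  { intros s. eapply is_derive_eq;
      [apply (is_derive_linear_comb g1 g2 (- b0) a0 0 s g1_smooth g2_smooth)|].
    unfold w, p, q; ring. }
  assert (Sa : forall s, inJ l s -> a (- s) + a s = 2 * a 0).
  { intros s Hs. assert (a (- s) + a s = a (- 0) + a 0) as E; [|rewrite Ropp_0 in E; lra].
    apply (is_derive_0_constant (- (l / 2)) (l / 2) (fun s => a (- s) + a s)); trivial.
    intros t Ht. eapply is_derive_eq;
      [apply is_derive_plusR; [apply is_derive_reflect, Da | apply Da]|].
    destruct (Sym t Ht) as [-> _]. ring. }
  assert (Sb : forall s, inJ l s -> b (- s) = b s).
  { intros s Hs. assert (b (- s) - b s = b (- 0) - b 0) as E; [|rewrite Ropp_0 in E; lra].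
    apply (is_derive_0_constant (- (l / 2)) (l / 2) (fun s => b (- s) - b s)); trivial.
    intros t Ht. eapply is_derive_eq;
      [apply is_derive_minusR; [apply is_derive_reflect, Db | apply Db]|].
    destruct (Sym t Ht) as [_ ->]. ring. }
  (* This is x - 2 <x - gamma(0), tau> tau, with tau = (a0, b0) the unit tangent at gamma(0). *)
  set (T := fun x => mkV2 (y1 x - 2 * (a0 * (y1 x - o1) + b0 * (y2 x - o2)) * a0)
                          (y2 x - 2 * (a0 * (y1 x - o1) + b0 * (y2 x - o2)) * b0)).
  assert (TG : forall s, inJ l s -> T (gamma s) = gamma (- s)).
  { intros s Hs. pose proof (Sa s Hs) as ES. pose proof (Sb s Hs) as EB.
    unfold a, b in ES, EB. fold o1 o2 in ES.
    apply V2_ext; unfold T; simpl; fold (g1 s) (g2 s) (g1 (- s)) (g2 (- s)).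
    - transitivity ((a0 * a0 + b0 * b0) * g1 s
        - (2 * (a0 * g1 s + b0 * g2 s) - 2 * (a0 * o1 + b0 * o2)) * a0); [rewrite U0; ring|].
      transitivity ((a0 * a0 + b0 * b0) * g1 (- s)); [|rewrite U0; ring].
      replace (2 * (a0 * o1 + b0 * o2)) with
        (a0 * g1 (- s) + b0 * g2 (- s) + (a0 * g1 s + b0 * g2 s)) by lra.
      assert (EB' : b0 * (- b0 * g1 (- s) + a0 * g2 (- s) + 0) = b0 * (- b0 * g1 s + a0 * g2 s + 0))
        by now rewrite EB.
      nra.
    - transitivity ((a0 * a0 + b0 * b0) * g2 s
        - (2 * (a0 * g1 s + b0 * g2 s) - 2 * (a0 * o1 + b0 * o2)) * b0); [rewrite U0; ring|].
      transitivity ((a0 * a0 + b0 * b0) * g2 (- s)); [|rewrite U0; ring].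
      replace (2 * (a0 * o1 + b0 * o2)) with
        (a0 * g1 (- s) + b0 * g2 (- s) + (a0 * g1 s + b0 * g2 s)) by lra.
      assert (EB' : a0 * (- b0 * g1 (- s) + a0 * g2 (- s) + 0) = a0 * (- b0 * g1 s + a0 * g2 s + 0))
        by now rewrite EB.
      nra. }
  exists T. split; [|split].
  - intros x y. unfold wdist, wnorm. f_equal. unfold T; simpl.
    set (X := y1 x - y1 y). set (Y := y2 x - y2 y).
    transitivity (X * X + Y * Y
      + 4 * (a0 * X + b0 * Y) * (a0 * X + b0 * Y) * (a0 * a0 + b0 * b0 - 1));
      [unfold X, Y; ring | rewrite U0; ring].
  (* The point gamma(0) + tau is sent to gamma(0) - tau. *)
  - exists (mkV2 (o1 + a0) (o2 + b0)). intros E. unfold T in E; simpl in E. injection E as E1 E2.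
    replace (a0 * (o1 + a0 - o1) + b0 * (o2 + b0 - o2)) with 1 in E1, E2 by (rewrite <- U0; ring).
    assert (a0 = 0) by lra. assert (b0 = 0) by lra. nra.
  - intros x. split.
    + intros (s & Hs & <-). exists (gamma (- s)). split; [exists (- s); auto|].
      rewrite TG by auto. now rewrite Ropp_involutive.
    + intros (y & (s & Hs & <-) & <-). exists (- s). rewrite TG; auto.
Qed.

End PlaneArc.

(** * Counting *)

(** Every family belongs to its own class, so equal classes make the two families agree for small
    widths. *)
Lemma germ_eq A B : germ A = germ B ->
  exists e0, 0 < e0 /\ forall e, 0 < e < e0 -> forall p, A e p -> B e p.
Proof.
  intros E. assert (H : germ B A).
  { rewrite <- E. exists 1. split; [lra|]. tauto. }
  destruct H as (e0 & He & H). exists e0. split; [exact He|].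
  intros e Hr p. apply (H e Hr).
Qed.

(** The angle is continuous and never 0, so one sign serves the whole interval; the cosine is
    injective on [0, pi]. *)
Lemma angle_eq_up_to_sign l alpha beta : smooth_fun alpha -> angular l alpha ->
  0 < l -> (forall s, inJ l s -> 0 < beta s < PI / 2) ->
  (forall s, inJ l s -> cos (alpha s) = cos (beta s)) ->
  (forall s, inJ l s -> alpha s = beta s) \/ (forall s, inJ l s -> alpha s = - beta s).
Proof.
  intros Sa Aa Hl Bb Ec. pose proof PI_RGT_0.
  assert (J0 : inJ l 0) by (unfold inJ; lra).
  assert (SS : forall f, smooth_fun f -> angular l f -> 0 < f 0 -> forall s, inJ l s -> 0 < f s).
  { intros f Sf Af P s Hs.
    refine (nonzero_same_sign (- (l / 2)) (l / 2) f _ _ 0 s J0 Hs P).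
    - intros t _. now apply (smooth_fun_Ck_at f 0).
    - intros t Ht. now apply Af. }
  destruct (Rtotal_order (alpha 0) 0) as [C|[C|C]].
  - right. intros s Hs.
    assert (0 < - alpha s).
    { apply (SS (fun t => - alpha t)); trivial;
        [now apply smooth_fun_opp | now apply angular_opp | lra]. }
    destruct (Aa s Hs) as [I _]. pose proof (Bb s Hs).
    assert (- alpha s = beta s); [|lra].
    apply cos_inj; try lra. rewrite cos_neg. now apply Ec.
  - destruct (Aa 0 J0); lra.
  - left. intros s Hs. assert (0 < alpha s) by now apply SS.
    destruct (Aa s Hs) as [I _]. pose proof (Bb s Hs).
    apply cos_inj; try lra. now apply Ec.
Qed.

(** The map s -> sigma s + d sends J into itself, and testing the two end points leaves only d =
    0. *)
Lemma admissible_geodesic_curvature c0 a b l gamma phi alpha : 0 < l ->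
  admissible_nf_with_generator c0 a b l gamma phi alpha ->
  exists sigma, (sigma = 1 \/ sigma = -1) /\ forall s, inJ l s ->
    curv (fun u => c0 (phi u)) s * cos (alpha s) = curv2 gamma (sigma * s).
Proof.
  intros Hl (_ & _ & _ & _ & (sigma & d & Hsig & H)).
  assert (d = 0) as ->.
  { destruct (H (l / 2)) as [B1 _]; [unfold inJ; lra|].
    destruct (H (- (l / 2))) as [B2 _]; [unfold inJ; lra|].
    unfold inJ in *. destruct Hsig; subst; lra. }
  exists sigma. split; [exact Hsig|]. intros s Hs. destruct (H s Hs) as [_ <-].
  f_equal; ring.
Qed.

Lemma curv_nonneg c s : 0 <= curv c s.
Proof.
  unfold curv. set (n := vnorm (vderiv c s)).
  destruct (vnorm_pos (vderiv c s)) as [P|E]; fold n in P || fold n in E.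
  - apply Rmult_le_pos; [apply vnorm_pos|]. apply Rlt_le, Rinv_0_lt_compat, pow_lt, P.
  (* At zero speed the quotient is a division by 0, whose value is 0 by convention. *)
  - rewrite <- E, pow_ne_zero, Rdiv_0_r by discriminate. lra.
Qed.

Theorem theoremA (c0 : R -> V3) (a b l : R) (gamma : R -> V2) :
  a < b ->
  vsmooth c0 ->
  (forall t, a <= t <= b -> vnorm (vderiv c0 t) <> 0) ->
  (forall t1 t2, a <= t1 <= b -> a <= t2 <= b -> c0 t1 = c0 t2 -> t1 = t2) ->
  (forall t, a <= t <= b -> curv c0 t <> 0) ->
  l = RInt (fun t => vnorm (vderiv c0 t)) a b ->
  0 < l ->
  wsmooth gamma ->
  (forall s, inJ l s -> wnorm (wderiv gamma s) = 1) ->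
  (forall s1 s2, inJ l s1 -> inJ l s2 -> gamma s1 = gamma s2 -> s1 = s2) ->
  (exists g, P_star c0 a b l gamma g) ->
  let Gamma := fun q => exists s, inJ l s /\ gamma s = q in
  (~ has_symmetry2 Gamma -> has_card (P_star c0 a b l gamma) 4) /\
  (has_symmetry2 Gamma -> has_card (P_star c0 a b l gamma) 2).
Proof.
  intros Hab Sc0 Rc0 Ic0 _ _ Hl Sg Ug Ig (g0 & phi & alpha0 & Hadm & _) Gamma.
  pose proof PI_RGT_0 as HPI.
  assert (J0 : inJ l 0) by (unfold inJ; lra).
  assert (Jn : forall s, inJ l s -> inJ l (- s)) by (intros s; unfold inJ; lra).
  set (c := fun u => c0 (phi u)).
  destruct (admissible_geodesic_curvature _ _ _ _ _ _ _ Hl Hadm) as (sigma0 & Hs0 & Mu0).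
  fold c in Mu0.
  destruct Hadm as (Hphi & Sa0 & Aa0 & Adm0 & _). fold c in Adm0.
  pose proof Hphi as (Sphi & _ & Rphi & Uc). fold c in Uc.
  assert (Sc : vsmooth c) by exact (vsmooth_comp c0 phi Sc0 Sphi).
  assert (Ic : forall s t, inJ l s -> inJ l t -> c s = c t -> s = t).
  { intros s t Hs Ht E. apply (arclength_param_injective c0 a b l Hab Hl Sc0 phi Hphi); trivial.
    apply Ic0; trivial; now apply Rphi. }
  (* admissibility at u = w forces the curvature to be positive *)
  assert (Kc : forall s, inJ l s -> 0 < curv c s).
  { intros s Hs. pose proof (Adm0 s s Hs Hs). pose proof (curv_nonneg c s).
    pose proof (angular_cos l alpha0 s Aa0 Hs). nra. }
  assert (Js : forall sigma s, sigma = 1 \/ sigma = -1 -> inJ l s -> inJ l (sigma * s)).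
  { intros sigma s H Hs. unfold inJ in *. destruct H; subst; lra. }
  assert (Mu0' : forall s, inJ l s -> curv2 gamma s = curv c (sigma0 * s) * cos (alpha0 (sigma0 * s))).
  { intros s Hs. rewrite Mu0 by now apply Js. f_equal. destruct Hs0; subst; ring. }
  assert (Kg : forall s, inJ l s -> 0 < curv2 gamma s).
  { intros s Hs. rewrite Mu0' by easy.
    apply Rmult_lt_0_compat; [|apply (angular_cos l); trivial]; auto. }
  (* Admissibility becomes a relation between gamma and c alone, so it passes to every angle with
     the same generator. *)
  assert (Kgc : forall s t, inJ l s -> inJ l t -> curv2 gamma s < curv c t).
  { intros s t Hs Ht. rewrite Mu0' by easy. apply Adm0; auto. }
  set (G := fun alpha => germ (origami_image l c alpha)).
  set (ok := fun sigma alpha => smooth_fun alpha /\ angular l alpha /\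
         forall s, inJ l s -> curv c s * cos (alpha s) = curv2 gamma (sigma * s)).
  assert (Mem : forall sigma alpha, sigma = 1 \/ sigma = -1 -> ok sigma alpha ->
            P_star c0 a b l gamma (G alpha)).
  { intros sigma alpha Hs (S & A & M). exists phi, alpha. split; [|reflexivity].
    split; [exact Hphi|]. split; [exact S|]. split; [exact A|]. fold c. split.
    - intros u w Hu Hw. rewrite M by easy. apply Kgc; auto.
    - exists sigma, 0. split; [exact Hs|]. intros s Hs'. rewrite Rplus_0_r.
      split; [auto|]. now rewrite M. }
  assert (Repr : forall g, P_star c0 a b l gamma g ->
            exists sigma alpha, (sigma = 1 \/ sigma = -1) /\ ok sigma alpha /\ g = G alpha).
  { intros g (psi & beta & Hadm & ->).
    destruct (admissible_geodesic_curvature _ _ _ _ _ _ _ Hl Hadm) as (sigma & Hs & Mu).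
    destruct Hadm as (Hpsi & Sb & Ab & _).
    assert (Sc' : vsmooth (fun u => c0 (psi u))) by exact (vsmooth_comp c0 psi Sc0 (proj1 Hpsi)).
    assert (Kext : forall d s, vsmooth d -> (forall t, inJ l t -> c0 (psi t) = d t) -> inJ l s ->
              curv (fun u => c0 (psi u)) s = curv d s).
    { intros d s Sd E Hs'.
      pose proof (vderiv_eq_on (- (l / 2)) (l / 2) _ d ltac:(lra) Sc' Sd E) as E1.
      pose proof (vderiv_eq_on (- (l / 2)) (l / 2) _ _ ltac:(lra)
        (vsmooth_vderiv _ Sc') (vsmooth_vderiv _ Sd) E1) as E2.
      unfold curv. now rewrite (E1 s Hs'), (E2 s Hs'). }
    destruct (arclength_param_unique c0 a b l Hab Hl Sc0 Rc0 phi psi Hphi Hpsi) as [E|E].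
    - assert (E' : forall t, inJ l t -> c0 (psi t) = c t).
      { intros t Ht. unfold c. now rewrite E. }
      exists sigma, beta. split; [exact Hs|]. split; [split; [exact Sb|split; [exact Ab|]]|].
      + intros s Hs'. rewrite <- (Kext c s Sc E' Hs'). now apply Mu.
      + unfold G. f_equal. now apply origami_image_eq_on.
    - set (cr := fun u => c (- u)).
      assert (Scr : vsmooth cr).
      { apply (vsmooth_comp c Ropp Sc). apply smooth_fun_intro; intros n x.
        apply (Ck_at_opp n (fun y => y)), Ck_at_id. }
      assert (E' : forall t, inJ l t -> c0 (psi t) = cr t).
      { intros t Ht. unfold cr, c. now rewrite E. }
      set (beta' := fun t => - beta (- t)).
      assert (Sb' : smooth_fun beta') by (apply smooth_fun_opp; now apply smooth_fun_reflect).
      (* Reversal replaces s by -s in the generator condition, whence the sign of sigma. *)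
      exists (- sigma), beta'. split; [destruct Hs; subst; lra|]. split; [split; [exact Sb'|split]|].
      + apply angular_opp. intros s Hs'. apply Ab; auto.
      + intros s Hs'. unfold beta'. rewrite cos_neg.
        replace (curv c s) with (curv (fun u => c0 (psi u)) (- s)).
        * rewrite Mu by auto. f_equal; ring.
        * rewrite (Kext cr (- s) Scr E') by auto. unfold cr.
          now rewrite (curv_reflect c (- s) Sc), Ropp_involutive.
      + unfold G. f_equal. rewrite (origami_image_eq_on l _ cr beta beta Hl Sc' Scr Sb Sb E') by easy.
        rewrite <- (origami_image_reflect l c beta' Sc Sb').
        f_equal. apply functional_extensionality; intros t. unfold beta'.
        now rewrite !Ropp_involutive. }
  assert (Inj : forall s1 s2 alpha1 alpha2, ok s1 alpha1 -> ok s2 alpha2 -> G alpha1 = G alpha2 ->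
            forall s, inJ l s -> alpha1 s = alpha2 s).
  { intros s1 s2 alpha1 alpha2 (S1 & A1 & _) (S2 & A2 & _) E s Hs.
    apply (germ_determines_angle l c Sc Uc Kc Ic alpha1 alpha2); trivial. now apply germ_eq. }
  destruct (angle_with_geodesic_curvature l c gamma 1 Hl Sc Sg (or_introl eq_refl) Uc Ug Kg Kgc)
    as (ap & Sap & Hap).
  destruct (angle_with_geodesic_curvature l c gamma (-1) Hl Sc Sg (or_intror eq_refl) Uc Ug Kg Kgc)
    as (am & Sam & Ham).
  assert (Ok : forall sigma al, smooth_fun al ->
    (forall s, inJ l s -> 0 < al s < PI / 2 /\ curv c s * cos (al s) = curv2 gamma (sigma * s)) ->
    ok sigma al /\ ok sigma (fun t => - al t)).
  { intros sigma al Sal Hal.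
    assert (A : angular l al) by (intros s Hs; destruct (Hal s Hs) as [I _]; lra).
    split; split; [exact Sal|split; [exact A|]|now apply smooth_fun_opp|split; [now apply angular_opp|]].
    - intros s Hs. now apply Hal.
    - intros s Hs. rewrite cos_neg. now apply Hal. }
  assert (Uniq : forall sigma al alpha, smooth_fun al ->
    (forall s, inJ l s -> 0 < al s < PI / 2 /\ curv c s * cos (al s) = curv2 gamma (sigma * s)) ->
    ok sigma alpha -> G al = G alpha \/ G (fun t => - al t) = G alpha).
  { intros sigma al alpha Sal Hal (S & A & M).
    destruct (angle_eq_up_to_sign l alpha al S A Hl) as [E|E].
    - intros s Hs. now apply Hal.
    - intros s Hs. apply Rmult_eq_reg_l with (curv c s); [|specialize (Kc s Hs); lra].
      rewrite M by easy. symmetry. now apply Hal.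
    - left. unfold G. f_equal. apply origami_image_eq_on; trivial. intros s Hs. now rewrite E.
    - right. unfold G. f_equal. apply origami_image_eq_on; trivial; [now apply smooth_fun_opp|].
      intros s Hs. now rewrite E. }
  destruct (Ok 1 ap Sap Hap) as [Okp Okp']. destruct (Ok (-1) am Sam Ham) as [Okm Okm'].
  assert (Npp : G ap <> G (fun t => - ap t)).
  { intros E. pose proof (Inj _ _ _ _ Okp Okp' E 0 J0). destruct (Hap 0 J0). lra. }
  split.
  - intros Hns.
    assert (exists s, inJ l s /\ curv2 gamma (- s) <> curv2 gamma s) as (s1 & Hs1 & Ns1).
    { apply NNPP; intros Hn. apply Hns. apply (curv2_even_symmetry l gamma Hl Sg Ug Kg).
      intros s Hs. apply NNPP; intros N. apply Hn. now exists s. }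
    (* Both angles are positive at s1, so their being different separates the germs of ap and -ap
       from those of am and -am. *)
    assert (Nap : ap s1 <> am s1).
    { intros E. apply Ns1. destruct (Hap s1 Hs1) as [_ E1]. destruct (Ham s1 Hs1) as [_ E2].
      rewrite E in E1. rewrite E1 in E2. rewrite Rmult_1_l in E2.
      replace (-1 * s1) with (- s1) in E2 by ring. now symmetry. }
    destruct (Hap s1 Hs1) as [Ip _]. destruct (Ham s1 Hs1) as [Im _].
    exists (G ap :: G (fun t => - ap t) :: G am :: G (fun t => - am t) :: nil).
    split; [reflexivity|split].
    + repeat constructor; simpl; intros Hin;
        repeat (destruct Hin as [Hin|Hin]; [symmetry in Hin|]); trivial.
      * now apply Npp.
      * pose proof (Inj _ _ _ _ Okp Okm Hin s1 Hs1). lra.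
      * pose proof (Inj _ _ _ _ Okp Okm' Hin s1 Hs1). lra.
      * pose proof (Inj _ _ _ _ Okp' Okm Hin s1 Hs1). lra.
      * pose proof (Inj _ _ _ _ Okp' Okm' Hin s1 Hs1). simpl in *. lra.
      * pose proof (Inj _ _ _ _ Okm Okm' Hin s1 Hs1). lra.
    + intros g. split.
      * intros Hg. destruct (Repr g Hg) as (sigma & alpha & [-> | ->] & Hok & ->).
        -- destruct (Uniq 1 ap alpha Sap Hap Hok); simpl; tauto.
        -- destruct (Uniq (-1) am alpha Sam Ham Hok); simpl; tauto.
      * intros [<-|[<-|[<-|[<-|[]]]]];
          [apply (Mem 1)|apply (Mem 1)|apply (Mem (-1))|apply (Mem (-1))]; tauto.
  - intros Hsym.
    pose proof (symmetry_curv2_even l gamma Hl Sg Ug Kg Ig Hsym) as Even.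
    exists (G ap :: G (fun t => - ap t) :: nil). split; [reflexivity|split].
    + repeat constructor; simpl; intros Hin;
        repeat (destruct Hin as [Hin|Hin]; [symmetry in Hin|]); trivial.
      now apply Npp.
    + intros g. split.
      * intros Hg. destruct (Repr g Hg) as (sigma & alpha & Hs & (S & A & M) & ->).
        (* Evenness turns the condition for sigma = -1 into the one for sigma = 1. *)
        assert (Hok : ok 1 alpha).
        { split; [exact S|split; [exact A|]]. intros s Hs'. rewrite M by easy.
          destruct Hs as [-> | ->]; [easy|]. rewrite Rmult_1_l, <- (Even s Hs'). f_equal; ring. }
        destruct (Uniq 1 ap alpha Sap Hap Hok); simpl; tauto.
      * intros [<-|[<-|[]]]; apply (Mem 1); tauto.
Qed.
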